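(* Let $\mathcal C$ be a fusion category (over $\mathbb C$) such that $K(\mathcal C)$ is commutative and dual-Burnside. Then $$\frac{\big(\prod_{i=1}^md_i\big)^2}{\mathrm{FPdim}(\mathcal C_{ad})}\in\mathbb Z.$$ Moreover, if additionally $\mathcal C$ is nilpotent, then $$\mathcal V(\mathcal C_{ad})=\bigcup_{i=1}^m\mathcal V(d_i^2).$$
   Context: $X_1,\dots,X_m$ are representatives of the isomorphism classes of simple objects of $\mathcal C$, $x_i=[X_i]\in K(\mathcal C)$ (the Grothendieck ring), $d_i=\mathrm{FPdim}(X_i)$. $\mathcal C_{ad}$ is the adjoint fusion subcategory, generated by all $X_i\otimes X_i^*$. $\mathcal C$ is nilpotent if the sequence $\mathcal C^{(0)}=\mathcal C$, $\mathcal C^{(n)}=(\mathcal C^{(n-1)})_{ad}$ reaches $\mathrm{Vec}$ for some $n$. For a non-negative integer $n$, $\mathcal V(n)$ is the set of prime divisors of $n$; for a weakly-integral fusion category $\mathcal D$ (i.e. $\mathrm{FPdim}(\mathcal D)\in\mathbb Z$), $\mathcal V(\mathcal D):=\mathcal V(\mathrm{FPdim}(\mathcal D))$. (A nilpotent fusion category is weakly-integral and then $d_i^2\in\mathbb Z$ for all $i$.) Let $H=K(\mathcal C)\otimes\mathbb C$ and let $\widehat{\mathcal B}=\{\mu_1=\mathrm{FPdim},\mu_2,\dots,\mu_m\}$ be the set of unital algebra morphisms $H\to\mathbb C$, a basis of $H^*$. The dual hypergroup of $K(\mathcal C)$ is $H^*$ with basis $\widehat{\mathcal B}$, product $(f\star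 g)(x_i/d_i)=f(x_i/d_i)g(x_i/d_i)$ for all $i$, unit $\mu_1$, involution $\mu_{j^\#}(x_i)=\mu_j([X_i^*])$. Write $\mu_i\star\mu_j=\sum_k\widehat p_k(i,j)\mu_k$; $\mu_j$ is grouplike in the dual if $\mu_j\star\mu_{j^\#}=\widehat p_1(j,j^\#)\mu_1$. $K(\mathcal C)$ is dual-Burnside if for every $\mu_j\in\widehat{\mathcal B}$: there is $i$ with $\mu_j(x_i)=0$ if and only if $\mu_j$ is not grouplike in the dual. *)

(* Defs.v *)
From HB Require Import structures.
From mathcomp Require Import all_boot all_order all_algebra.
From mathcomp Require Import complex.
From mathcomp Require Import all_classical all_reals.

Set Implicit Arguments.
Unset Strict Implicit.
Unset Printing Implicit Defensive.

Import Order.TTheory GRing.Theory Num.Theory.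

Local Open Scope classical_set_scope.
Local Open Scope ring_scope.
Local Open Scope complex_scope.

Record linear_category (K : fieldType) : Type := LinearCategory {
  obj :> Type;
  hom : obj -> obj -> vectType K;
  idm : forall A : obj, hom A A;
  (* comp g f is "g after f" *)
  comp : forall A B C : obj, hom B C -> hom A B -> hom A C;
  comp_idl : forall (A B : obj) (f : hom A B), comp (idm B) f = f;
  comp_idr : forall (A B : obj) (f : hom A B), comp f (idm A) = f;
  comp_assoc : forall (A B C D : obj)
      (h : hom C D) (g : hom B C) (f : hom A B),
    comp h (comp g f) = comp (comp h g) f;
  comp_linl : forall (A B C : obj) (a : K) (g g' : hom B C) (f : hom A B),
    comp (a *: g + g') f = a *: comp g f + comp g' f;
  comp_linr : forall (A B C : obj) (a : K) (g : hom B C) (f f' : hom A B),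
    comp g (a *: f + f') = a *: comp g f + comp g f'
}.

Arguments hom {K} _ _ _.
Arguments idm {K _} A.
Arguments comp {K _ A B C} g f.

Notation "g '\oc' f" := (comp g f) (at level 40, left associativity).

Section Abelian.
Context {K : fieldType} {C : linear_category K}.
Implicit Types A B S X Y : C.

Definition is_iso A B (f : hom C A B) : Prop :=
  exists g : hom C B A, g \oc f = idm A /\ f \oc g = idm B.

Definition isomorphic A B : Prop := exists f : hom C A B, is_iso f.

Definition is_zero A : Prop := idm A = 0.

Definition is_mono A B (f : hom C A B) : Prop :=
  forall (T : C) (u v : hom C T A), f \oc u = f \oc v -> u = v.

Definition is_epi A B (f : hom C A B) : Prop :=
  forall (T : C) (u v : hom C B T), u \oc f = v \oc f -> u = v.

Definition is_kernel A B (f : hom C A B) (N : C) (k : hom C N A) : Prop :=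
  f \oc k = 0 /\
  forall (T : C) (t : hom C T A), f \oc t = 0 ->
    exists! u : hom C T N, k \oc u = t.

Definition is_cokernel A B (f : hom C A B) (Q : C) (q : hom C B Q) : Prop :=
  q \oc f = 0 /\
  forall (T : C) (t : hom C B T), t \oc f = 0 ->
    exists! u : hom C Q T, u \oc q = t.

Definition direct_sum (n : nat) (A : 'I_n -> C) (S : C) : Prop :=
  exists (inj : forall i, hom C (A i) S) (proj : forall i, hom C S (A i)),
    [/\ forall i, proj i \oc inj i = idm (A i),
        forall i j, i != j -> proj j \oc inj i = 0
      & \sum_(i < n) inj i \oc proj i = idm S].

(* For n = 0 the first clause provides a zero object. *)
Definition abelian_category : Prop :=
  [/\ forall (n : nat) (A : 'I_n -> C), exists S, direct_sum A S,
      forall A B (f : hom C A B), exists N (k : hom C N A), is_kernel f k,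
      forall A B (f : hom C A B), exists Q (q : hom C B Q), is_cokernel f q,
      forall A B (f : hom C A B), is_mono f ->
        exists D (g : hom C B D), is_kernel g f
    & forall A B (f : hom C A B), is_epi f ->
        exists D (g : hom C D A), is_cokernel g f].

Definition simple X : Prop :=
  ~ is_zero X /\
  forall Y (f : hom C Y X), is_mono f -> is_zero Y \/ is_iso f.

Definition semisimple_object X : Prop :=
  exists (n : nat) (A : 'I_n -> C), (forall i, simple (A i)) /\ direct_sum A X.

Definition simple_representatives (m : nat) (X : 'I_m -> C) : Prop :=
  [/\ forall i, simple (X i),
      forall i j, isomorphic (X i) (X j) -> i = j
    & forall Y, simple Y -> exists i, isomorphic Y (X i)].

End Abelian.

Arguments abelian_category {K} C.

Record tensor_category (K : fieldType) : Type := TensorCategory {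
  tcat :> linear_category K;
  tens : tcat -> tcat -> tcat;
  tensm : forall A A' B B' : tcat,
    hom tcat A A' -> hom tcat B B' -> hom tcat (tens A B) (tens A' B');
  one : tcat;
  assoc : forall A B C : tcat,
    hom tcat (tens (tens A B) C) (tens A (tens B C));
  associ : forall A B C : tcat,
    hom tcat (tens A (tens B C)) (tens (tens A B) C);
  lunit : forall A : tcat, hom tcat (tens one A) A;
  runit : forall A : tcat, hom tcat (tens A one) A;
  tensm_id : forall A B : tcat, tensm (idm A) (idm B) = idm (tens A B);
  tensm_comp : forall (A A' A'' B B' B'' : tcat)
      (f' : hom tcat A' A'') (f : hom tcat A A')
      (g' : hom tcat B' B'') (g : hom tcat B B'),
    tensm (f' \oc f) (g' \oc g) = tensm f' g' \oc tensm f g;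
  tensm_linl : forall (A A' B B' : tcat) (a : K)
      (f f' : hom tcat A A') (g : hom tcat B B'),
    tensm (a *: f + f') g = a *: tensm f g + tensm f' g;
  tensm_linr : forall (A A' B B' : tcat) (a : K)
      (f : hom tcat A A') (g g' : hom tcat B B'),
    tensm f (a *: g + g') = a *: tensm f g + tensm f g';
  assocK : forall A B C : tcat, associ A B C \oc assoc A B C = idm _;
  associK : forall A B C : tcat, assoc A B C \oc associ A B C = idm _;
  lunit_iso : forall A : tcat, is_iso (lunit A);
  runit_iso : forall A : tcat, is_iso (runit A);
  assoc_nat : forall (A A' B B' C C' : tcat)
      (f : hom tcat A A') (g : hom tcat B B') (h : hom tcat C C'),
    assoc A' B' C' \oc tensm (tensm f g) h =
    tensm f (tensm g h) \oc assoc A B C;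
  lunit_nat : forall (A A' : tcat) (f : hom tcat A A'),
    lunit A' \oc tensm (idm one) f = f \oc lunit A;
  runit_nat : forall (A A' : tcat) (f : hom tcat A A'),
    runit A' \oc tensm f (idm one) = f \oc runit A;
  pentagon : forall A B C D : tcat,
    tensm (idm A) (assoc B C D) \oc assoc A (tens B C) D
      \oc tensm (assoc A B C) (idm D) =
    assoc A B (tens C D) \oc assoc (tens A B) C D;
  triangle : forall A B : tcat,
    tensm (idm A) (lunit B) \oc assoc A one B = tensm (runit A) (idm B)
}.

Arguments tens {K _} A B.
Arguments tensm {K _ A A' B B'} f g.
Arguments one {K} _.
Arguments assoc {K _} A B C.
Arguments associ {K _} A B C.
Arguments lunit {K _} A.
Arguments runit {K _} A.

(* Y is a left dual of X, with evaluation ev and coevaluation coev; then X is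
   a right dual of Y. *)
Definition is_left_dual (K : fieldType) (C : tensor_category K) (X Y : C)
    (ev : hom C (tens Y X) (one C)) (coev : hom C (one C) (tens X Y)) : Prop :=
  runit X \oc tensm (idm X) ev \oc assoc X Y X \oc tensm coev (idm X)
    = lunit X
  /\
  lunit Y \oc tensm ev (idm Y) \oc associ Y X Y \oc tensm (idm Y) coev
    = runit Y.

Record fusion_category (R : realType) : Type := FusionCategory {
  fcat :> tensor_category R[i];
  fusion_abelian : abelian_category fcat;
  fusion_semisimple : forall X : fcat, semisimple_object X;
  fusion_finite :
    exists (m : nat) (X : 'I_m -> fcat), simple_representatives X;
  fusion_unit_simple : simple (one fcat);
  dual : fcat -> fcat;
  fusion_left_rigid : forall X : fcat, exists ev coev,
    @is_left_dual _ fcat X (dual X) ev coev;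
  fusion_right_rigid : forall X : fcat, exists (Y : fcat) ev coev,
    @is_left_dual _ fcat Y X ev coev
}.

Arguments dual {R _} X.

Section Subcategories.
Context {R : realType} {C : fusion_category R}.

(* A full replete subcategory of C is given by its set of objects
   (closure under isomorphism is a case of closure under subobjects). *)
Definition fusion_subcategory (D : set C) : Prop :=
  [/\ D (one C),
      forall (n : nat) (A : 'I_n -> C) (S : C),
        (forall i, D (A i)) -> direct_sum A S -> D S,
      forall (A B : C) (f : hom C A B),
        (D B -> is_mono f -> D A) /\ (D A -> is_epi f -> D B),
      forall A B : C, D A -> D B -> D (tens A B)
    & forall A : C, D A -> D (dual A)].

Definition adjoint_subcategory (D : set C) : set C :=
  smallest fusion_subcategory
    [set Y | exists X : C, [/\ D X, simple X & Y = tens X (dual X)]].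

Definition Vec : set C :=
  [set Y | exists n : nat, direct_sum (fun _ : 'I_n => one C) Y].

End Subcategories.

Definition nilpotent (R : realType) (C : fusion_category R) : Prop :=
  exists n : nat, iter n adjoint_subcategory [set: C] = Vec.

Section Grothendieck.
Context {R : realType} {C : fusion_category R} {m : nat}.
Variable X : 'I_m -> C.

Definition mult (Y : C) (k : 'I_m) : nat := \dim {: hom C (X k) Y}.

(* The Grothendieck ring with coefficients in T is the free T-module 'rV[T]_m
   on the classes of the X i: K(C) is the case T = int, and its
   complexification H is the case T = R[i]. *)
Definition gclass (T : comNzRingType) (Y : C) : 'rV[T]_m :=
  \row_k (mult Y k)%:R.

Definition gmul (T : comNzRingType) (u v : 'rV[T]_m) : 'rV[T]_m :=
  \sum_(i < m) \sum_(j < m) (u 0 i * v 0 j) *: gclass T (tens (X i) (X j)).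

Definition grothendieck_commutative : Prop :=
  forall u v : 'rV[int]_m, gmul u v = gmul v u.

(* Left multiplication by the class of Y, acting on row vectors. *)
Definition left_mult_mx (Y : C) : 'M[R]_m :=
  \matrix_(i, k) (mult (tens Y (X i)) k)%:R.

Definition FPdim (Y : C) : R :=
  sup [set a : R | 0 <= a /\ eigenvalue (left_mult_mx Y) a].

Definition FPdim_subcategory (D : set C) : R :=
  \sum_(i < m | X i \in D) FPdim (X i) ^+ 2.

Local Notation H := 'rV[R[i]]_m.
Local Notation Hdual := 'Hom(H, R[i]^o).

Definition basis_elt (i : 'I_m) : H := gclass _ (X i).

Definition functional (c : 'I_m -> R[i]) : Hdual :=
  linfun (fun h : H => \sum_(i < m) h 0 i * c i : R[i]^o).

Definition FPdim_functional : Hdual := functional (fun i => (FPdim (X i))%:C).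

Definition Bhat : set Hdual :=
  [set mu : Hdual | mu (gclass _ (one C)) = 1 /\
    forall u v : H, mu (gmul u v) = (mu u : R[i]) * mu v].

Definition star (f g : Hdual) : Hdual :=
  functional (fun i =>
    let d := (FPdim (X i))%:C in
    d * (f (d^-1 *: basis_elt i) * g (d^-1 *: basis_elt i))).

Definition sharp (f : Hdual) : Hdual :=
  functional (fun i => f (gclass _ (dual (X i)))).

(* The sum over Bhat is a finitely supported one.  The family p is unique since
   distinct algebra morphisms are linearly independent, and it exists when Bhat
   is a basis of H^*; 0 is a default value. *)
Definition dual_coef (mu nu : Hdual) : Hdual -> R[i] :=
  xget (fun=> 0) [set p : Hdual -> R[i] |
    (forall rho, ~ Bhat rho -> p rho = 0) /\
    star mu nu = \sum_(rho \in Bhat) p rho *: rho].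

Definition dual_grouplike (mu : Hdual) : Prop :=
  star mu (sharp mu) = dual_coef mu (sharp mu) FPdim_functional *:
                       FPdim_functional.

Definition dual_burnside : Prop :=
  forall mu, Bhat mu ->
    ((exists i : 'I_m, mu (basis_elt i) = 0) <-> ~ dual_grouplike mu).

End Grothendieck.

(* Prime divisors of a real number that is a non-negative integer. *)
Definition prime_divisors (R : realType) (x : R) : set nat :=
  [set p : nat | prime p /\ exists2 n : nat, x = n%:R & (p %| n)%N].

(* Main.v *)
From HB Require Import structures.
From mathcomp Require Import all_boot all_order all_algebra all_field.
From mathcomp Require Import complex.
From mathcomp Require Import all_classical all_reals.
Require Import Defs.

(* Write P for the product of all x_i and P' for the product of their duals.
   If an algebra morphism mu vanishes at no x_i then it is grouplike in the
   dual, so mu(x_i) mu(dual x_i) = d_i^2 for all i; since |mu(x_k)| <= d_k, this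
   forces mu = FPdim on every constituent of every x_i (dual x_i), hence on
   C_ad, and mu(P P') = D^2 with D the product of the d_i. If mu vanishes at
   some x_i then mu(P P') = 0 and mu differs from FPdim somewhere on C_ad, so mu
   kills the regular element e, the sum of the d_k x_k over C_ad, because
   x_k e = d_k e for x_k in C_ad. Thus FPdim(C_ad) P P' and D^2 e have the same
   image under all morphisms; they are equal, and the coefficient of the unit
   shows that D^2 / FPdim(C_ad) is a natural number.

   For fusion subcategories S and T = S_ad, the T-orbits of simple objects
   inside one S-orbit all have the same dimension. Going down the chain of iterated
   adjoint subcategories to Vec, the dimension of an orbit of x_i is a multiple
   of d_i^2, so FPdim(C_ad) is an integer multiple of the rational algebraic
   integer d_i^2. Conversely the first part bounds the prime divisors of
   FPdim(C_ad) by those of D^2. *)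

Set Implicit Arguments.
Unset Strict Implicit.
Unset Printing Implicit Defensive.

Import Order.TTheory GRing.Theory Num.Theory.

Local Open Scope ring_scope.

(** * Positive symmetric matrices *)

Section PerronFrobenius.
Variables (R : rcfType) (m : nat) (M : 'M[R]_m).
Hypotheses (M_sym : M^T = M) (M_gt0 : forall i j, 0 < M i j).
Local Open Scope complex_scope.
Local Open Scope sesquilinear_scope.

(* Take a unitary eigenvector [r] for an eigenvalue of largest modulus [a], and
   [w] the vector of moduli of the entries of [r]. By the triangle inequality
   [w (a - M) w^T <= 0], while [a - M] is positive semidefinite; hence
   [w (a - M) = 0]. *)
Lemma symmetric_positive_eigenvector : (0 < m)%N ->
  exists (w : 'rV[R]_m) (a : R), (forall k, 0 < w 0 k) /\ w *m M = a *: w.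
Proof.
move=> m_gt0; pose A : 'M[R[i]]_m := map_mx (real_complex R) M.
have A_herm : A \is hermsymmx.
  apply: realsym_hermsym.
    by apply/is_hermitianmxP; rewrite expr0 scale1r map_mx_id // /A map_trmx
      M_sym.
  by apply/mxOverP => i j; rewrite mxE; apply/complex_realP; exists (M i j).
pose P := spectralmx A; pose D := spectral_diag A.
have PU : P \is unitarymx := spectral_unitarymx A.
have PV : invmx P = P^t* := invmx_unitary PU.
have AE : A = P^t* *m diag_mx D *m P.
  by rewrite -PV; apply/orthomx_spectralP/hermitian_normalmx.
have D_real k : D 0 k = (complex.Re (D 0 k))%:C.
  by rewrite RRe_real // (mxOverP (hermitian_spectral_diag_real A_herm)).
pose dl k := complex.Re (D 0 k).
pose j := [arg max_(k > Ordinal m_gt0) `|dl k|]%O.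
have dl_le k : dl k <= `|dl j|.
  by rewrite (le_trans (ler_norm _)) // /j; case: arg_maxP => // i _; apply.
set a := `|dl j| in dl_le.
pose r := row j P.
have rA : r *m A = D 0 j *: r.
  rewrite /r AE -row_mul !mulmxA (unitarymxP PU) mul1mx row_mul.
  by apply/rowP=> k; rewrite !mxE (bigD1 j) //= !mxE eqxx mulr1n big1 ?addr0 //
    => l lj; rewrite !mxE eq_sym (negPf lj) mul0r.
pose w : 'rV[R]_m := \row_k complex.Re `|r 0 k|.
have wE k : (w 0 k)%:C = `|r 0 k| by rewrite mxE RRe_real ?normr_real.
have w_ge0 k : 0 <= w 0 k by rewrite -lecR wE normr_ge0.
have w_sup k : a * w 0 k <= \sum_l w 0 l * M l k.
  rewrite -lecR rmorphM /= wE rmorph_sum /=.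
  have -> : (a%:C : R[i]) = `|D 0 j| by rewrite D_real /a normc_def /= expr0n
    addr0 sqrtr_sqr.
  rewrite -normrM; have -> : D 0 j * r 0 k = \sum_l r 0 l * A l k.
    by have /rowP/(_ k) := rA; rewrite !mxE => <-.
  apply: le_trans (ler_norm_sum _ _ _) _; apply: ler_sum => l _.
  have Alk : A l k = (M l k)%:C by rewrite mxE.
  by rewrite rmorphM /= wE normrM Alk [`|(M l k)%:C|]ger0_norm // ler0c ltW.
pose wC : 'rV[R[i]]_m := map_mx (real_complex R) w.
pose c := wC *m P^t*.
have wCE : wC = c *m P by rewrite /c -mulmxA -PV mulVmx ?mulmx1 ?unitarymx_unit.
(* The eigenvalues of [a - M], nonnegative because [a] is the largest modulus of an eigenvalue of
   [M]. *)
pose E : 'rV[R[i]]_m := \row_k (a%:C - D 0 k).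
have wAE : wC *m (a%:C%:M - A) = c *m diag_mx E *m P.
  rewrite mulmxBr [in RHS](_ : diag_mx E = a%:C%:M - diag_mx D); last first.
    by apply/matrixP=> x y; rewrite !mxE; case: eqP => _;
      rewrite ?mulr1n ?mulr0n ?subrr.
  rewrite mulmxBr mulmxBl AE !mulmxA -/c; congr (_ - _).
  by rewrite mul_mx_scalar mul_mx_scalar -scalemxAl -wCE.
have wAk k : (wC *m (a%:C%:M - A)) 0 k
    = (a * w 0 k - \sum_l w 0 l * M l k)%:C.
  rewrite mulmxBr mul_mx_scalar rmorphB rmorphM rmorph_sum /= !mxE.
  by congr (_ - _); apply: eq_bigr => l _; rewrite !mxE rmorphM.
have wCt k : (wC^t*) k 0 = (w 0 k)%:C.
  by rewrite !mxE; apply/CrealP/complex_realP; eexists.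
have q_le0 : (wC *m (a%:C%:M - A) *m wC^t*) 0 0 <= 0.
  rewrite mxE; apply: sumr_le0 => k _.
  by rewrite wAk wCt -rmorphM lecR mulr_le0_ge0 // subr_le0.
have E_ge0 l : 0 <= E 0 l.
  by rewrite mxE D_real -rmorphB ler0c subr_ge0; apply: dl_le.
have qE : (wC *m (a%:C%:M - A) *m wC^t*) 0 0 = \sum_l E 0 l * `|c 0 l| ^+ 2.
  rewrite wAE {1}wCE trmx_mul map_mxM /= !mulmxA -(mulmxA (c *m _)).
  rewrite (unitarymxP PU) mulmx1 mxE; apply: eq_bigr => l _.
  by rewrite mul_mx_diag !mxE normCK mulrCA mulrA.
have cE : c *m diag_mx E = 0.
  have q0 : \sum_l E 0 l * `|c 0 l| ^+ 2 == 0.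
    by rewrite -qE eq_le q_le0 qE sumr_ge0 // => l _;
      rewrite mulr_ge0 ?exprn_ge0.
  rewrite psumr_eq0 in q0; last by move=> l _; rewrite mulr_ge0 ?exprn_ge0.
  apply/rowP => l; rewrite mul_mx_diag [LHS]mxE [RHS]mxE.
  have := allP q0 l (mem_index_enum l); rewrite mulf_eq0 expf_eq0 /= normr_eq0.
  by case/orP => /eqP ->; rewrite ?mul0r ?mulr0.
have wM k : a * w 0 k = \sum_l w 0 l * M l k.
  apply/eqP; rewrite -subr_eq0; have := wAk k; rewrite wAE cE mul0mx mxE.
  by move=> /esym/(@complexI _ _ 0) ->.
exists w, a; split; last by apply/rowP=> k; rewrite [LHS]mxE [RHS]mxE wM.
(* If [w] were zero, so would be [r], a row of a unitary matrix. *)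
have [k0 wk0] : exists k, 0 < w 0 k.
  apply/existsP; apply: contraT; rewrite negb_exists => /forallP w0.
  have r0 : r = 0.
    apply/rowP => k; rewrite [RHS]mxE; apply/eqP; rewrite -normr_eq0 -wE.
    have -> : w 0 k = 0 by apply/eqP; rewrite eq_le w_ge0 andbT leNgt w0.
    by rewrite rmorph0.
  have := row_unitarymxP PU j j; rewrite -/r r0 linear0l eqxx => /esym/eqP.
  by rewrite oner_eq0.
(* One positive entry of [w] and the positivity of [M] make every entry of [w M = a w] positive, so
   no entry of [w] is zero. *)
have Mw_gt0 k : 0 < \sum_l w 0 l * M l k.
  rewrite (bigD1 k0) //= ltr_wpDr ?mulr_gt0 //.
  by rewrite sumr_ge0 // => l _; rewrite mulr_ge0 // ltW.
move=> k; have := Mw_gt0 k; rewrite -wM.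
by rewrite lt_neqAle eq_sym mulf_eq0 negb_or => /andP[/andP[_ wk] _];
  rewrite lt_neqAle eq_sym wk w_ge0.
Qed.

Lemma positive_eigenvector_unique (w u : 'rV[R]_m) (a : R) : (0 < m)%N ->
  (forall k, 0 < w 0 k) -> w *m M = a *: w -> u *m M = a *: u ->
  exists t, u = t *: w.
Proof.
move=> m_gt0 w_gt0 wM uM.
(* The least ratio is the largest [t] for which [u - t w] is still nonnegative. *)
pose j := [arg min_(k < Ordinal m_gt0) (u 0 k / w 0 k)]%O.
pose t := u 0 j / w 0 j; exists t.
have t_le k : t <= u 0 k / w 0 k.
  by rewrite /t /j; case: arg_minP => // i _; apply.
(* [z] is a nonnegative eigenvector with a zero entry, so it is zero *)
pose z := u - t *: w.
have z_ge0 k : 0 <= z 0 k by rewrite !mxE subr_ge0 -ler_pdivlMr.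
have zj : z 0 j = 0 by rewrite !mxE mulfVK ?subrr // gt_eqF.
have zM : z *m M = a *: z by rewrite mulmxBl -scalemxAl wM uM scalerBr !scalerA
  mulrC.
have /eqP : \sum_l z 0 l * M l j = 0.
  by have /rowP/(_ j) := zM; rewrite mxE => ->; rewrite mxE zj mulr0.
rewrite psumr_eq0 => [/allP z0|l _]; last by rewrite mulr_ge0 // ltW.
apply/eqP; rewrite -subr_eq0; apply/eqP/rowP => l; rewrite [RHS]mxE.
have := z0 l (mem_index_enum l); rewrite mulf_eq0 (gt_eqF (M_gt0 _ _)) orbF.
by move/eqP.
Qed.

End PerronFrobenius.

(** * Commutative based rings *)

Lemma sum_nat_neq0 (I : finType) (F : I -> nat) :
  (\sum_i F i != 0)%N -> exists i, F i != 0%N.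
Proof. by rewrite sum_nat_eq0 negb_forall => /existsP[x]; exists x. Qed.

(* [cf i j k] is the multiplicity of [x_k] in [x_i x_j]. *)
Record based_ring (m : nat) := BasedRing {
  cf : 'I_m -> 'I_m -> 'I_m -> nat;
  bunit : 'I_m;
  bstar : 'I_m -> 'I_m;
  cfC : forall i j k, cf i j k = cf j i k;
  cfA : forall i j l k,
    (\sum_p cf i j p * cf p l k = \sum_q cf j l q * cf i q k)%N;
  cf1 : forall i k, cf bunit i k = (i == k);
  cf_star : forall i j k, cf (bstar i) k j = cf i j k;
  bstarK : involutive bstar
}.

Section BasedRing.
Variables (m : nat) (B : based_ring m).
Local Notation N := (cf B).
Local Notation u := (bunit B).
Local Notation s := (bstar B).
Implicit Types i j k l p q : 'I_m.

Lemma rank_gt0 : (0 < m)%N. Proof. exact: leq_trans (ltn_ord u). Qed.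

Lemma cf1r i k : N i u k = (i == k). Proof. by rewrite cfC cf1. Qed.

Lemma cf_starl i : N (s i) i u = 1%N. Proof. by rewrite cf_star cf1r eqxx. Qed.

(** Multiplicities are natural numbers, so nothing cancels in [cfA]: a nonzero term on one side
    forces one on the other. *)
Lemma cf_assoc_supp i j l k p : N i j p != 0%N -> N p l k != 0%N ->
  exists2 q, N j l q != 0%N & N i q k != 0%N.
Proof.
move=> ijp plk; have : (\sum_q N j l q * N i q k != 0)%N.
  rewrite -cfA -lt0n (bigD1 p) //= ltn_addr // muln_gt0.
  by rewrite !lt0n ijp.
move=> /sum_nat_neq0[q]; rewrite muln_eq0 negb_or => /andP[].
by exists q.
Qed.

Lemma cf_transitive j k : exists i, N i j k != 0%N.
Proof.
have [||q _ jqk] := @cf_assoc_supp j (s j) k k u.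
- by rewrite cfC cf_starl.
- by rewrite cf1 eqxx.
by exists q; rewrite cfC.
Qed.

Section Matrices.
Variable T : comNzRingType.

Definition Lmx i : 'M[T]_m := \matrix_(j, k) (N i j k)%:R.

Lemma Lmx_mul i j : Lmx i *m Lmx j = \sum_k (N i j k)%:R *: Lmx k.
Proof.
apply/matrixP => a b; rewrite mxE summxE.
under eq_bigr do rewrite !mxE -natrM; under [RHS]eq_bigr do rewrite !mxE -natrM.
by rewrite -!natr_sum -cfA; under eq_bigr do rewrite cfC.
Qed.

Lemma Lmx_comm i j : Lmx i *m Lmx j = Lmx j *m Lmx i.
Proof. by rewrite !Lmx_mul; apply: eq_bigr => k _; rewrite cfC. Qed.

Lemma Lmx_unit : Lmx u = 1%:M.
Proof. by apply/matrixP => a b; rewrite !mxE cf1. Qed.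

Lemma Lmx_tr i : (Lmx i)^T = Lmx (s i).
Proof. by apply/matrixP => a b; rewrite !mxE cf_star. Qed.

Definition is_char (mu : 'I_m -> T) : Prop :=
  mu u = 1 /\ forall i j, mu i * mu j = \sum_k (N i j k)%:R * mu k.

End Matrices.

(** The matrices [Lmx i] represent the ring, so their eigenvalues on a common eigenvector multiply
    as the [x_i] do. *)
Lemma eigen_char (F : fieldType) (v : 'rV[F]_m) (a : 'I_m -> F) :
  v != 0 -> (forall i, v *m Lmx F i = a i *: v) -> is_char a.
Proof.
move=> v0 va; have inj (x y : F) : x *: v = y *: v -> x = y.
  move/eqP; rewrite -subr_eq0 -scalerBl scaler_eq0 (negPf v0) orbF subr_eq0.
  by move/eqP.
split; first by apply: inj; rewrite -va Lmx_unit mulmx1 scale1r.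
move=> i j; apply: inj; rewrite -scalerA -va scalemxAl -va -mulmxA Lmx_mul.
rewrite mulmx_sumr scaler_suml; apply: eq_bigr => k _.
by rewrite -scalemxAr va scalerA.
Qed.

(** A positive character; over the reals it can only be FPdim, by [FPdimE]. *)
Definition is_dim (F : numDomainType) (d : 'I_m -> F) : Prop :=
  (forall i, 0 < d i) /\ is_char d.

(** Pair the vector of the [|v k|] with [d]: the triangle inequality and the multiplicativity of [d]
    bound [|a|] times this positive number by [d i] times it. *)
Lemma dim_bound (F : numDomainType) (d v : 'I_m -> F) (a : F) i :
  is_dim d -> (forall k, a * v k = \sum_j v j * (N i j k)%:R) ->
  (exists k, v k != 0) -> `|a| <= d i.
Proof.
move=> [d_gt0 [_ dM]] va [k0 vk0].
have vd_gt0 : 0 < \sum_k `|v k| * d k.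
  rewrite (bigD1 k0) //= ltr_pwDl ?mulr_gt0 ?normr_gt0 //.
  by apply: sumr_ge0 => k _; rewrite mulr_ge0 // ltW.
rewrite -(ler_pM2r vd_gt0).
have -> : d i * (\sum_k `|v k| * d k)
    = \sum_k (\sum_j `|v j| * (N i j k)%:R) * d k.
  rewrite mulr_sumr; under [RHS]eq_bigr do rewrite mulr_suml.
  rewrite exchange_big; apply: eq_bigr => j _ /=.
  by rewrite mulrCA dM mulr_sumr; apply: eq_bigr => k _; rewrite mulrA.
rewrite mulr_sumr; apply: ler_sum => k _; rewrite mulrA ler_wpM2r ?(ltW (d_gt0
  k)) //.
rewrite -normrM va; apply: le_trans (ler_norm_sum _ _ _) _.
by apply: ler_sum => j _; rewrite normrM normr_nat.
Qed.

Section Dim.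
Variables (F : numFieldType) (d : 'I_m -> F).
Hypothesis d_dim : is_dim d.
Let d_gt0 i : 0 < d i. Proof. by case: d_dim. Qed.
Let dM i j : d i * d j = \sum_k (N i j k)%:R * d k. Proof. by case: d_dim => _
  []. Qed.
Let d_ge0 i : 0 <= d i. Proof. exact: ltW. Qed.
Let d_neq0 i : d i != 0. Proof. by rewrite gt_eqF. Qed.

Lemma dim_unit : d u = 1. Proof. by case: d_dim => _ []. Qed.

(** By [cf_star], the row of values of [mu] is an eigenvector of [Lmx i] with eigenvalue
    [mu (s i)]. *)
Lemma char_eigen (mu : 'I_m -> F) i k : is_char mu ->
  mu (s i) * mu k = \sum_j mu j * (N i j k)%:R.
Proof. by case=> _ ->; apply: eq_bigr => j _; rewrite cf_star mulrC. Qed.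

Lemma char_le_star (mu : 'I_m -> F) i : is_char mu -> `|mu (s i)| <= d i.
Proof.
move=> muC; apply: dim_bound (fun k => char_eigen i k muC) _ => //.
by exists u; case: muC => ->; rewrite oner_eq0.
Qed.

(** The bound on characters, applied to [d] itself, gives one inequality; the involution gives the
    other. *)
Lemma dim_star i : d (s i) = d i.
Proof.
have le k : d (s k) <= d k by have := char_le_star k d_dim.2; rewrite ger0_norm.
by apply/eqP; rewrite eq_le le -{1}(bstarK B i) le.
Qed.

Lemma char_le (mu : 'I_m -> F) i : is_char mu -> `|mu i| <= d i.
Proof. by move/(char_le_star (s i)); rewrite bstarK dim_star. Qed.

End Dim.

End BasedRing.

Lemma dim_complex (R : rcfType) m (B : based_ring m) (d : 'I_m -> R) :
  is_dim B d -> is_dim B (fun i => real_complex R (d i)).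
Proof.
move=> [d0 [d1 dM]]; split; first by move=> i; rewrite ltcR.
split; first by rewrite d1.
move=> i j; rewrite -rmorphM dM rmorph_sum; apply: eq_bigr => k _.
by rewrite rmorphM rmorph_nat.
Qed.

Lemma exists_dim (R : rcfType) m (B : based_ring m) :
  exists d : 'I_m -> R, is_dim B d.
Proof.
(* The Perron-Frobenius eigenvector of [M] is unique up to scaling, so it is a
   common eigenvector of the [Lmx i], which commute with [M]. *)
pose M : 'M[R]_m := \sum_i Lmx B R i.
have ME j k : M j k = (\sum_i cf B i j k)%:R.
  by rewrite summxE natr_sum; apply: eq_bigr => i _; rewrite mxE.
have M_sym : M^T = M.
  rewrite /M linear_sum /= [RHS](reindex_inj (inv_inj (bstarK B))).
  by apply: eq_bigr => i _; rewrite Lmx_tr.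
have M_gt0 j k : 0 < M j k.
  have [x] := cf_transitive B j k.
  by rewrite -lt0n ME ltr0n (bigD1 x) //= => x0; rewrite ltn_addr.
have m_gt0 := rank_gt0 B.
have [w [a [w_gt0 wM]]] := symmetric_positive_eigenvector M_sym M_gt0 m_gt0.
have w_eig i : exists t, w *m Lmx B R i == t *: w.
  have [|t ->] := positive_eigenvector_unique (u := w *m Lmx B R i) M_gt0 m_gt0
    w_gt0 wM.
    rewrite -mulmxA (_ : _ *m M = M *m Lmx B R i) ?mulmxA ?wM -?scalemxAl //.
    rewrite mulmx_sumr mulmx_suml; apply: eq_bigr => k _; exact: Lmx_comm.
  by exists t.
pose d i := xchoose (w_eig i).
have wd i : w *m Lmx B R i = d i *: w by apply/eqP/(xchooseP (w_eig i)).
have w0 : w != 0.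
  by apply/eqP => /rowP/(_ (bunit B)); apply/eqP; rewrite mxE gt_eqF.
have d_char : is_char B d := eigen_char w0 wd.
have d_ge0 i : 0 <= d i.
  rewrite -(pmulr_lge0 _ (w_gt0 (bunit B))).
  have /rowP/(_ (bunit B)) := wd i; rewrite [RHS]mxE => <-; rewrite mxE.
  by apply: sumr_ge0 => j _; rewrite mxE mulr_ge0 // ltW.
(* If [d i] were zero, the product [d (s i) * d i] would vanish, although it is a sum of nonnegative
   terms containing [d u = 1]. *)
exists d; split=> // i; rewrite lt_neqAle d_ge0 andbT eq_sym.
apply: contraTneq isT => di0; have [d1 /(_ (bstar B i) i)] := d_char.
move=> /eqP; rewrite di0 mulr0 eq_sym psumr_eq0 => [/allP/(_ (bunit B))|k _].
  by rewrite mem_index_enum cf_starl d1 mulr1 oner_eq0 => /(_ isT).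
by rewrite mulr_ge0.
Qed.

(** * Characters separate the elements of the complexified ring *)

Section CharSeparation.
Variables (F : numClosedFieldType) (m : nat) (B : based_ring m).
Local Open Scope sesquilinear_scope.

Lemma Lmx_normal i : Lmx B F i \is normalmx.
Proof.
have E : (Lmx B F i)^t* = Lmx B F (bstar B i).
  by rewrite Lmx_tr; apply/matrixP => a b; rewrite !mxE conjC_nat.
by apply/normalmxP; rewrite E Lmx_comm.
Qed.

(** The commuting normal matrices [Lmx i] are simultaneously diagonalizable, and every row of the
    diagonalizing matrix yields a character. Hence the combination of the [Lmx i] with coefficients
    [h] is zero, and its row at the unit is [h]. *)
Lemma char_separate (h : 'I_m -> F) :
  (forall mu, is_char B mu -> \sum_i h i * mu i = 0) -> forall i, h i = 0.
Proof.
move=> h0; pose Ls := [seq Lmx B F i | i <- enum 'I_m].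
have [|P Pu /allP PL] := (codiagonalizableP Ls).1.
  split=> [_ _ /mapP[i _ ->] /mapP[j _ ->]|_ /mapP[i _ ->]];
    first exact: Lmx_comm.
  have /orthomx_spectralP E := Lmx_normal i; exists (spectralmx (Lmx B F i)).
    exact: spectral_unit.
  by apply/(similar_diagLR (spectral_unit _));
    exists (spectral_diag (Lmx B F i));
    rewrite conjVmx ?spectral_unit.
have PLi i : {D : 'rV_m | P *m Lmx B F i = diag_mx D *m P}.
  apply: sig_eqW; have /PL /similar_diagPex[D] : Lmx B F i \in Ls by rewrite
    map_f ?mem_enum.
  by move=> /(similarP Pu) E; exists D.
pose a r i := sval (PLi i) 0 r.
have rP r i : row r P *m Lmx B F i = a r i *: row r P.
  rewrite -row_mul (svalP (PLi i)); apply/rowP => k.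
  by rewrite mxE mul_diag_mx !mxE.
have r0 r : row r P != 0.
  apply: contraTneq Pu => rP0; rewrite unitmxE (expand_det_row _ r) big1
    ?unitr0 //.
  by move=> k _; have /rowP/(_ k) := rP0; rewrite !mxE => ->; rewrite mul0r.
have hL : \sum_i h i *: Lmx B F i = 0.
  apply: (can_inj (mulKmx Pu)); rewrite mulmx0; apply/row_matrixP => r.
  rewrite row_mul row0 mulmx_sumr.
  under eq_bigr do rewrite -scalemxAr rP scalerA.
  by rewrite -scaler_suml h0 ?scale0r //; apply: eigen_char (r0 r) (rP r).
move=> k; have /matrixP/(_ (bunit B) k) := hL;
  rewrite summxE [RHS]mxE (bigD1 k) //=.
rewrite !mxE cf1r eqxx mulr1 big1 ?addr0 // => i ik.
by rewrite !mxE cf1r (negPf ik) mulr0.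
Qed.

End CharSeparation.

(** * Based subrings and the dimensions of their orbits *)

Section FusionSubset.
Variables (m : nat) (B : based_ring m).
Local Notation N := (cf B).
Local Notation u := (bunit B).
Local Notation s := (bstar B).
Implicit Types (i j k l : 'I_m) (S T : {pred 'I_m}).

Definition based_subring S : Prop :=
  [/\ u \in S,
      forall i j k, i \in S -> j \in S -> N i j k != 0%N -> k \in S
    & forall i, i \in S -> s i \in S].

(** The basis elements of the [S]-submodule generated by [x_i]; for a based subring [S] these are
    the classes of an equivalence relation. *)
Definition orbit_of S i : {pred 'I_m} := [pred k | [exists a in S, N a i k !=
  0%N]].

Lemma orbit_ofP S i k :
  reflect (exists2 a, a \in S & N a i k != 0%N) (k \in orbit_of S i).
Proof. exact: exists_inP. Qed.

Section Orbits.
Variable S : {pred 'I_m}.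
Hypothesis S_sub : based_subring S.

Lemma orbit_of_refl i : i \in orbit_of S i.
Proof. by apply/orbit_ofP; exists u; [case: S_sub | rewrite cf1 eqxx]. Qed.

Lemma orbit_of_sym i k : k \in orbit_of S i -> i \in orbit_of S k.
Proof.
move/orbit_ofP => [a aS aik]; apply/orbit_ofP; exists (s a).
  by case: S_sub => _ _; apply.
by rewrite cf_star.
Qed.

Lemma orbit_of_trans i j k :
  j \in orbit_of S i -> k \in orbit_of S j -> k \in orbit_of S i.
Proof.
move=> /orbit_ofP[a aS aij] /orbit_ofP[b bS bjk].
have [||q aq biq] := @cf_assoc_supp _ B i a b k j.
- by rewrite cfC.
- by rewrite cfC.
apply/orbit_ofP; exists q; last by rewrite cfC.
by case: S_sub => _ SM _; apply: SM aq.
Qed.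

Lemma orbit_of_eq i k : k \in orbit_of S i -> orbit_of S k =i orbit_of S i.
Proof.
move=> ik l; apply/idP/idP; first exact: orbit_of_trans.
exact: orbit_of_trans (orbit_of_sym ik).
Qed.

Lemma orbit_of_unit : orbit_of S u =i S.
Proof.
move=> k; apply/orbit_ofP/idP => [[a aS]|kS].
  by rewrite cf1r; have [<-|] := eqVneq a k.
by exists k => //; rewrite cf1r eqxx.
Qed.
End Orbits.

Section Dimension.
Variables (F : numFieldType) (d : 'I_m -> F).
Hypothesis d_dim : is_dim B d.

Definition dim_of S : F := \sum_(i in S) d i ^+ 2.

Lemma dim_of_eq S T : S =i T -> dim_of S = dim_of T.
Proof. by move=> ST; apply: eq_bigl. Qed.

Lemma dim_of_gt0 S : u \in S -> 0 < dim_of S.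
Proof.
move=> uS; rewrite /dim_of (bigD1 u) //= (dim_unit d_dim) expr1n ltr_pwDl //.
by apply: sumr_ge0 => i _; rewrite exprn_ge0 // ltW //; case: d_dim.
Qed.

Section Refinement.
Variables S T : {pred 'I_m}.
Hypotheses (S_sub : based_subring S) (T_sub : based_subring T).
Hypothesis ad : forall i k, i \in S -> N i (s i) k != 0%N -> k \in T.

(** Multiplication by [x_a] respects [T]-orbits. Moving [x_t] past [x_a] links [k] to a constituent
    [q] of [x_a x_y]; two constituents [q], [z] of [x_a x_y] are linked by a constituent of
    [x_a x_a^*], which lies in [T] by [ad]. *)
Lemma orbit_of_mul a i k y z : a \in S -> N a i k != 0%N ->
  y \in orbit_of T i -> N a y z != 0%N -> z \in orbit_of T k.
Proof.
move=> aS aik yi ayz; have /orbit_ofP[t tT tyi] := orbit_of_sym T_sub yi.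
have [||q yaq tqk] := @cf_assoc_supp _ B t y a k i; rewrite // 1?cfC //.
have [||p sap pz] := @cf_assoc_supp _ B q (s a) a z y.
- by rewrite cfC cf_star cfC.
- by rewrite cfC.
apply: (orbit_of_trans T_sub (j := q)).
  by apply: orbit_of_sym => //; apply/orbit_ofP; exists t.
by apply/orbit_ofP; exists p; [apply: ad aS _; rewrite cfC | rewrite cfC].
Qed.

(* The right-hand side is symmetric under exchanging [i], [a] with [k], [a^*].
  *)
Lemma dim_of_orbit_sum a i k : a \in S -> N a i k != 0%N ->
  d a * dim_of (orbit_of T i)
    = \sum_(y in orbit_of T i) \sum_(z in orbit_of T k) (N a y z)%:R * (d y * d
      z).
Proof.
move=> aS aik; rewrite mulr_sumr; apply: eq_bigr => y yi.
rewrite expr2 mulrA; have [_ [_ ->]] := d_dim; rewrite mulr_suml.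
rewrite [RHS]big_mkcond /=; apply: eq_bigr => z _.
case: ifPn => [_|zk]; first by rewrite -mulrA [d z * _]mulrC.
have [->|ayz] := eqVneq (N a y z) 0%N; first by rewrite !mul0r.
by rewrite (orbit_of_mul aS aik yi ayz) in zk.
Qed.

(** Multiplied by [d a = d (s a)], both dimensions become the same double sum. *)
Lemma dim_of_orbit_eq i k : k \in orbit_of S i ->
  dim_of (orbit_of T k) = dim_of (orbit_of T i).
Proof.
move=> /orbit_ofP[a aS aik]; have da : d a != 0 by rewrite gt_eqF //;
  case: d_dim.
apply: (mulfI da); rewrite -{1}(dim_star d_dim a) (dim_of_orbit_sum (k := i))
  ?cf_star //;
  last by case: S_sub => _ _; apply.
rewrite (dim_of_orbit_sum aS aik) exchange_big; apply: eq_bigr => y _.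
by apply: eq_bigr => z _; rewrite cf_star [d z * _]mulrC.
Qed.

Lemma dim_of_orbit_mul i : {subset T <= S} ->
  exists n, dim_of (orbit_of S i) = n%:R * dim_of (orbit_of T i).
Proof.
(* Equal orbits yield the same pick, so [rep] labels the [T]-orbits, and [n] is the number of those
   inside the [S]-orbit of [i]. *)
move=> TS; pose rep k := [pick x in orbit_of T k].
have repE k x : (rep k == rep x) = (k \in orbit_of T x).
  apply/eqP/idP => [|kx]; last by apply: eq_pick => y; exact: orbit_of_eq.
  rewrite /rep; case: pickP => [y yk|/(_ k)]; last by rewrite orbit_of_refl.
  case: pickP => // z zx [yz]; apply: (orbit_of_trans T_sub zx).
  by rewrite -yz; apply: orbit_of_sym.
pose C := [set rep k | k in orbit_of S i]; exists #|C|.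
rewrite {1}/dim_of (partition_big_imset rep) /= -sum1_card natr_sum mulr_suml.
apply: eq_bigr => _ /imsetP[x xi ->]; rewrite mul1r -(dim_of_orbit_eq xi).
apply: eq_bigl => k; rewrite repE andb_idl // => /orbit_ofP[a aT axk].
apply: (orbit_of_trans S_sub xi); apply/orbit_ofP; exists a => //; exact: TS.
Qed.

End Refinement.
End Dimension.
End FusionSubset.

(** * Characters compared with the dimension, and the divisibility statement *)

Section Quotient.
Variables (R : rcfType) (m : nat) (B : based_ring m) (d : 'I_m -> R).
Hypothesis d_dim : is_dim B d.
Local Notation N := (cf B).
Local Notation u := (bunit B).
Local Notation s := (bstar B).
Local Notation dC := (fun i => real_complex R (d i)).
Let dC_dim : is_dim B dC := dim_complex d_dim.

(** Equality case of the triangle inequality: each term on the left is bounded in modulus by its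
    counterpart for [d], and the sums agree. *)
Lemma char_eq_dim_supp (mu : 'I_m -> R[i]) i j : is_char B mu ->
  mu i * mu j = dC i * dC j -> forall k, N i j k != 0%N -> mu k = dC k.
Proof.
move=> muC; case: (muC) (dC_dim) => _ -> [_ [_ ->]] E k Nk.
apply: (mulfI (_ : (N i j k)%:R != 0)); first by rewrite pnatr_eq0.
apply: (normC_sum_upper _ E) => // l _.
by rewrite normrM normr_nat ler_wpM2l ?ler0n ?(char_le dC_dim).
Qed.

(** The kernel of [mu]: products stay in it by the equality case above, duals by the assumed value
    of [mu i * mu (s i)]. *)
Lemma char_eq_dim_subring (mu : 'I_m -> R[i]) : is_char B mu ->
  (forall i, mu i * mu (s i) = dC i ^+ 2) ->
  based_subring B [pred k | mu k == dC k].
Proof.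
move=> muC mu_star; split=> [|i j k|i]; rewrite !inE.
- by rewrite (dim_unit dC_dim); case: muC => ->.
- move=> /eqP mi /eqP mj Nk; apply/eqP.
  by apply: (char_eq_dim_supp muC _ Nk); rewrite mi mj.
move=> /eqP mi; have := mu_star i; rewrite mi expr2 => /mulfI -> //.
  by rewrite (dim_star dC_dim).
by rewrite gt_eqF //; case: dC_dim.
Qed.

(** The [w k] are the multiplicities in the product along [l]. They are chosen before [mu], as
    comparing all characters at once by [char_separate] requires. *)
Lemma char_prod (l : seq 'I_m) : exists w : 'I_m -> nat,
  forall mu : 'I_m -> R[i], is_char B mu ->
    \prod_(i <- l) mu i = \sum_k (w k)%:R * mu k.
Proof.
elim: l => [|i l [w wP]].
  exists (fun k => (k == u) : nat) => mu [mu1 _].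
  rewrite big_nil (bigD1 u) //= eqxx mu1 mul1r big1 ?addr0 // => k /negPf ->.
  by rewrite mul0r.
exists (fun k => \sum_j w j * N i j k)%N => mu muC; rewrite big_cons wP //.
under [RHS]eq_bigr do rewrite natr_sum mulr_suml.
rewrite exchange_big mulr_sumr; apply: eq_bigr => j _ /=.
case: muC => _ muM; rewrite mulrCA muM mulr_sumr; apply: eq_bigr => k _.
by rewrite natrM mulrA.
Qed.

(* [x_k e = d_k e] for the regular element [e] of the subring [S]. *)
Lemma char_dim_sum (S : {pred 'I_m}) (mu : 'I_m -> R[i]) k :
  based_subring B S -> is_char B mu -> k \in S ->
  mu k * (\sum_(i in S) dC i * mu i) = dC k * (\sum_(i in S) dC i * mu i).
Proof.
move=> S_sub [_ muM] kS.
(* By [cf_star] this is the expansion of [d (s k) * d x], which has no term outside [S]. *)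
have SM x : x \in S -> \sum_(i in S) (N k i x)%:R * dC i = dC k * dC x.
  move=> xS; rewrite -(dim_star dC_dim k); have [_ [_ ->]] := dC_dim.
  rewrite big_mkcond; apply: eq_bigr => y _; rewrite cf_star;
    case: ifPn => // yS.
  have [->|Ny] := eqVneq (N k y x) 0%N; first by rewrite mul0r.
  case/negP: yS; case: S_sub => _ /(_ (s k) x y) + /(_ k kS) sk.
  by apply=> //; rewrite cf_star.
rewrite mulr_sumr; under eq_bigr do rewrite mulrCA muM mulr_sumr.
have -> : \sum_(i in S) \sum_x dC i * ((N k i x)%:R * mu x)
        = \sum_(i in S) \sum_(x in S) dC i * ((N k i x)%:R * mu x).
  apply: eq_bigr => i iS; rewrite [RHS]big_mkcond; apply: eq_bigr => x _.
  case: ifPn => // xS; have [->|Nx] := eqVneq (N k i x) 0%N.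
    by rewrite mul0r mulr0.
  by case/negP: xS; case: S_sub => _ SM' _; apply: SM' kS iS Nx.
rewrite exchange_big mulr_sumr; apply: eq_bigr => x xS /=.
by rewrite mulrA -SM // mulr_suml; apply: eq_bigr => i _;
  rewrite mulrA [dC i * _]mulrC.
Qed.

(** The dichotomy on characters is the form in which the dual-Burnside property enters; [n] is the
    multiplicity of the unit in the product of all [x_i] and their duals. *)
Lemma dim_prod_sqr (S : {pred 'I_m}) :
  based_subring B S -> (forall i k, N i (s i) k != 0%N -> k \in S) ->
  (forall mu : 'I_m -> R[i], is_char B mu ->
     (exists i, mu i = 0) \/
     (forall k, k \in S -> mu k = dC k) /\ forall i, mu i * mu (s i) = dC i ^+
       2) ->
  exists n : nat, (\prod_i d i) ^+ 2 = n%:R * dim_of d S.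
Proof.
move=> S_sub ad dich; have uS : u \in S by case: S_sub.
have [w wP] := char_prod (index_enum 'I_m ++ map s (index_enum 'I_m)).
(* [h] lists the coefficients of the difference of the two elements to be identified. *)
pose D := \prod_i dC i; pose h k := dim_of dC S * (w k)%:R - (k \in S)%:R * (D
  ^+ 2 * dC k).
have h0 : forall k, h k = 0.
  apply: (char_separate (B := B)) => mu muC.
  under eq_bigr do rewrite mulrBl -mulrA.
  rewrite sumrB -mulr_sumr -wP // big_cat big_map /= -big_split /=.
  have -> : \sum_i (i \in S)%:R * (D ^+ 2 * dC i) * mu i
          = D ^+ 2 * \sum_(i in S) dC i * mu i.
    rewrite mulr_sumr [RHS]big_mkcond; apply: eq_bigr => k _.
    by case: (k \in S); rewrite ?mul1r ?mul0r ?mulrA.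
  have [[i mui]|[muS mu_star]] := dich mu muC.
    rewrite (bigD1 i) //= mui !mul0r mulr0 sub0r; apply/eqP; rewrite oppr_eq0.
    rewrite mulf_eq0; apply/orP; right.
    (* If [mu] agreed with [d] on all of [S], then [mu i * mu (s i)] would be [d i * d (s i)], which
       is not zero. *)
    have [k kS muk] : exists2 k, k \in S & mu k != dC k.
      apply/exists_inP; apply: contraT; rewrite negb_exists_in => /forall_inP
        all.
      have /eqP : mu i * mu (s i) = dC i * dC (s i).
        case: (muC) (dC_dim) => _ -> [_ [_ ->]]; apply: eq_bigr => k _.
        have [->|Nk] := eqVneq (N i (s i) k) 0%N; first by rewrite !mul0r.
        by have /negPn/eqP -> := all k (ad _ _ Nk).
      rewrite mui mul0r eq_sym mulf_eq0; have [dC0 _] := dC_dim.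
      by rewrite !gt_eqF.
    have /eqP := char_dim_sum S_sub muC kS.
    by rewrite -subr_eq0 -mulrBl mulf_eq0 subr_eq0 (negPf muk).
  under eq_bigr do rewrite mu_star; rewrite prodrXl -/D [dim_of _ _ * _]mulrC.
  apply/eqP; rewrite subr_eq0; apply/eqP; congr (_ * _).
  by apply: eq_bigr => k kS; rewrite muS // expr2.
exists (w u); have := h0 u; rewrite /h uS mul1r (dim_unit dC_dim) mulr1 => /eqP.
rewrite subr_eq0 => /eqP E; apply: (@complexI R).
rewrite rmorphXn rmorph_prod /= -/D -E mulrC rmorphM rmorph_nat /dim_of
  rmorph_sum.
by congr (_ * _); apply: eq_bigr => k _; rewrite rmorphXn.
Qed.

End Quotient.

(** * Integrality of squared dimensions *)

Lemma monic_rat_root_int (F : numFieldType) (p : {poly int}) (q : rat) :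
  p \is monic -> root (map_poly intr p) (ratr q : F) -> exists z : int, q =
    z%:~R.
Proof.
have map_ratr (K : numFieldType) : map_poly intr p = map_poly ratr (map_poly
  intr p) :> {poly K}.
  by rewrite -map_poly_comp; apply: eq_map_poly => z /=; rewrite ratr_int.
move=> p_monic; rewrite map_ratr fmorph_root => q_root.
(* The root is rational, so it can be moved from [F] to [algC], where rational algebraic integers
   are integers. *)
have : (ratr q : algC) \in Num.int.
  apply: Cint_rat_Aint; first exact: Crat_rat.
  apply: (@root_monic_Aint (map_poly intr p)).
  - by rewrite map_ratr fmorph_root.
  - exact: monic_map.
  by apply/polyOverP => k; rewrite coef_map intr_int.
by move=> /intrP[z zq]; exists z; apply: (fmorph_inj (@ratr algC));
  rewrite /= zq ratr_int.
Qed.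

Section Integrality.
Variables (F : numFieldType) (m : nat) (B : based_ring m) (d : 'I_m -> F).
Hypothesis d_dim : is_dim B d.

Lemma dim_row_eigen i : (\row_k d k) *m Lmx B F i = d i *: \row_k d k.
Proof.
apply/rowP => k; rewrite !mxE -(dim_star d_dim) (char_eigen _ _ d_dim.2).
by apply: eq_bigr => j _; rewrite !mxE.
Qed.

(** [d i ^+ 2] is an eigenvalue of the integer matrix of multiplication by [x_i x_i^*], hence an
    algebraic integer; being the rational number [Q / n], it is an integer. *)
Lemma sqr_dim_nat i (n Q : nat) : (0 < n)%N -> Q%:R = n%:R * d i ^+ 2 ->
  exists e : nat, d i ^+ 2 = e%:R.
Proof.
move=> n_gt0 E; have [d_gt0 [_ dM]] := d_dim.
have n0 : (n%:R : F) != 0 by rewrite pnatr_eq0 -lt0n.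
pose A : 'M[int]_m := \sum_k (cf B i (bstar B i) k)%:R *: Lmx B int k.
have dA : (\row_k d k) *m map_mx intr A = d i ^+ 2 *: \row_k d k.
  have -> : map_mx intr A = \sum_k (cf B i (bstar B i) k)%:R *: Lmx B F k.
    apply/matrixP => a b; rewrite mxE !summxE rmorph_sum; apply: eq_bigr => k _.
    by rewrite !mxE rmorphM !rmorph_nat.
  rewrite mulmx_sumr expr2 -{2}(dim_star d_dim i) dM scaler_suml.
  by apply: eq_bigr => k _; rewrite -scalemxAr dim_row_eigen scalerA.
have eq : d i ^+ 2 = ratr (Q%:R / n%:R).
  by rewrite fmorph_div !rmorph_nat E mulrC mulKf.
have [|z qz] := @monic_rat_root_int F (char_poly A) (Q%:R / n%:R)
  (char_poly_monic A).
  rewrite map_char_poly -eigenvalue_root_char -eq; apply/eigenvalueP.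
  exists (\row_k d k) => //; apply/eqP => /rowP/(_ i); apply/eqP.
  by rewrite !mxE gt_eqF.
have z_ge0 : 0 <= z.
  by rewrite -(ler0z F) -(ratr_int F) -qz -eq exprn_ge0 // ltW.
by exists `|z|%N; rewrite eq qz ratr_int natr_absz ger0_norm.
Qed.

End Integrality.

(** * Semisimple linear categories *)

Section VectorDimension.
Variable K : fieldType.

Lemma dim_le_inj (V W : vectType K) (f : V -> W) :
  linear f -> (forall v, f v = 0 -> v = 0) -> (\dim {:V} <= \dim {:W})%N.
Proof.
move=> f_lin f_inj; pose fL := HB.pack_for {linear V -> W} f
  (GRing.isLinear.Build K V W *:%R f f_lin).
rewrite -(limg_dim_eq (f := linfun fL)) ?dimvS ?subvf //.
apply/eqP; rewrite -subv0; apply/subvP => v;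
  rewrite memv_cap memv_ker => /andP[_].
by rewrite lfunE => /eqP /f_inj ->; rewrite mem0v.
Qed.

Lemma dim_direct_sum (V : vectType K) n (W : 'I_n -> vectType K)
    (f : forall i, W i -> V) (g : forall i, V -> W i) :
  (forall i, linear (f i)) -> (forall i, linear (g i)) ->
  (forall i w, g i (f i w) = w) ->
  (forall i j w, i != j -> g j (f i w) = 0) ->
  (forall v, \sum_i f i (g i v) = v) ->
  \dim {:V} = (\sum_i \dim {:W i})%N.
Proof.
move=> f_lin g_lin gf gf0 fg.
pose fL i := HB.pack_for {linear W i -> V} (f i) (GRing.isLinear.Build K (W i)
  V *:%R (f i) (f_lin i)).
pose gL i := HB.pack_for {linear V -> W i} (g i) (GRing.isLinear.Build K V (W
  i) *:%R (g i) (g_lin i)).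
pose U i := limg (linfun (fL i)).
have UP i v : v \in U i -> exists w, v = f i w.
  by move=> /memv_imgP[w _ ->]; exists w; rewrite lfunE.
have dU : directv (\sum_i U i).
  apply/directv_sum_independent => us Uus us0 i _.
  have [w wE] := UP i _ (Uus i isT); rewrite wE.
  have : gL i (\sum_j us j) = w.
    rewrite linear_sum (bigD1 i) //= wE gf big1 ?addr0 // => j ji.
    by have [x ->] := UP j _ (Uus j isT); rewrite gf0.
  by rewrite us0 linear0 => <-; rewrite -[f i 0]/(fL i 0) linear0.
have -> : {:V}%VS = (\sum_i U i)%VS.
  apply/eqP; rewrite eqEsubv subvf andbT; apply/subvP => v _.
  rewrite -(fg v); apply: memv_sumr => i _; apply/memv_imgP.
  by exists (g i v); rewrite ?memvf // lfunE.
rewrite (directvP dU) /=; apply: eq_bigr => i _; rewrite /U limg_dim_eq //.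
apply/eqP; rewrite -subv0; apply/subvP => v;
  rewrite memv_cap memv_ker => /andP[_].
by rewrite lfunE /= => /eqP fv0; rewrite -(gf i v) fv0 -[g i 0]/(gL i 0)
  linear0 mem0v.
Qed.

Lemma dim_neq0P (V : vectType K) : reflect (exists v : V, v != 0) (\dim {:V} !=
  0%N).
Proof.
rewrite dimv_eq0; apply: (iffP idP) => [V0|[v v0]].
  by exists (vpick {:V}); rewrite vpick0.
by apply: contra v0 => /eqP V0; rewrite -memv0 -V0 memvf.
Qed.

End VectorDimension.

Section LinearCategory.
Variables (K : fieldType) (C : linear_category K).
Implicit Types A B X Y T S : C.

Lemma comp0l A B D (f : hom C A B) : (0 : hom C B D) \oc f = 0.
Proof.
by have := comp_linl (-1) (0 : hom C B D) 0 f;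
  rewrite scaler0 addr0 scaleN1r addNr.
Qed.

Lemma comp0r A B D (f : hom C B D) : f \oc (0 : hom C A B) = 0.
Proof.
by have := comp_linr (-1) f (0 : hom C A B) 0;
  rewrite scaler0 addr0 scaleN1r addNr.
Qed.

Lemma compDl A B D (g h : hom C B D) (f : hom C A B) :
  (g + h) \oc f = g \oc f + h \oc f.
Proof. by have := comp_linl 1 g h f; rewrite !scale1r. Qed.

Lemma compDr A B D (f : hom C B D) (g h : hom C A B) :
  f \oc (g + h) = f \oc g + f \oc h.
Proof. by have := comp_linr 1 f g h; rewrite !scale1r. Qed.

Lemma compBr A B D (f : hom C B D) (g h : hom C A B) :
  f \oc (g - h) = f \oc g - f \oc h.
Proof.
by have := comp_linr (-1) f h g; rewrite !scaleN1r addrC [RHS]addrC.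
Qed.

Lemma comp_suml A B D n (g : 'I_n -> hom C B D) (f : hom C A B) :
  (\sum_i g i) \oc f = \sum_i g i \oc f.
Proof.
by apply: (big_morph (fun g => g \oc f)) => [x y|]; rewrite ?compDl ?comp0l.
Qed.

Lemma comp_sumr A B D n (f : hom C B D) (g : 'I_n -> hom C A B) :
  f \oc (\sum_i g i) = \sum_i f \oc g i.
Proof.
by apply: (big_morph (fun g => f \oc g)) => [x y|]; rewrite ?compDr ?comp0r.
Qed.

Lemma is_iso_idm A : is_iso (idm A).
Proof. by exists (idm A); rewrite comp_idl. Qed.

Lemma is_iso_comp A B D (g : hom C B D) (f : hom C A B) :
  is_iso g -> is_iso f -> is_iso (g \oc f).
Proof.
move=> [g' [g'g gg']] [f' [f'f ff']]; exists (f' \oc g'); split.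
  by rewrite -comp_assoc (comp_assoc g') g'g comp_idl.
by rewrite -comp_assoc (comp_assoc f) ff' comp_idl.
Qed.

Lemma is_iso_inv A B (f : hom C A B) : is_iso f ->
  exists g : hom C B A, [/\ is_iso g, g \oc f = idm A & f \oc g = idm B].
Proof. by move=> [g [gf fg]]; exists g; split=> //; exists f. Qed.

Lemma isomorphic_sym A B : isomorphic A B -> isomorphic B A.
Proof. by move=> [f /is_iso_inv[g [gi _ _]]]; exists g. Qed.

Lemma isomorphic_trans B A D : isomorphic A B -> isomorphic B D -> isomorphic A
  D.
Proof. by move=> [f fi] [g gi]; exists (g \oc f); apply: is_iso_comp. Qed.

Lemma is_iso_mono A B (f : hom C A B) : is_iso f -> is_mono f.
Proof.
by move=> [g [gf _]] T x y /(congr1 (comp g)); rewrite !comp_assoc gf !comp_idl.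
Qed.

Lemma is_iso_epi A B (f : hom C A B) : is_iso f -> is_epi f.
Proof.
move=> [g [_ fg]] T x y /(congr1 (fun h => h \oc g)).
by rewrite -!comp_assoc fg !comp_idr.
Qed.

Lemma mono_eq0 A B T (f : hom C A B) (g : hom C T A) :
  is_mono f -> f \oc g = 0 -> g = 0.
Proof. by move=> fm fg0; apply: fm; rewrite comp0r. Qed.

Lemma epi_eq0 A B T (f : hom C A B) (g : hom C B T) :
  is_epi f -> g \oc f = 0 -> g = 0.
Proof. by move=> fe gf0; apply: fe; rewrite comp0l. Qed.

Lemma dim_hom_mono A B T (f : hom C A B) : is_mono f ->
  (\dim {:hom C T A} <= \dim {:hom C T B})%N.
Proof.
move=> fm; apply: (dim_le_inj (f := comp f)) => [a g h|g];
  first exact: comp_linr.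
exact: mono_eq0.
Qed.

Lemma dim_hom_epi A B T (f : hom C A B) : is_epi f ->
  (\dim {:hom C B T} <= \dim {:hom C A T})%N.
Proof.
move=> fe; apply: (dim_le_inj (f := fun g => g \oc f)) => [a g h|g].
  exact: comp_linl.
exact: epi_eq0.
Qed.

Lemma dim_hom_isor A B T : isomorphic A B ->
  \dim {:hom C T A} = \dim {:hom C T B}.
Proof.
move=> AB; apply/eqP; rewrite eqn_leq.
have [f /is_iso_mono fm] := AB; have [g /is_iso_mono gm] := isomorphic_sym AB.
by rewrite (dim_hom_mono _ fm) (dim_hom_mono _ gm).
Qed.

Lemma dim_hom_isol A B T : isomorphic A B ->
  \dim {:hom C A T} = \dim {:hom C B T}.
Proof.
move=> AB; apply/eqP; rewrite eqn_leq.
have [f /is_iso_epi fm] := AB; have [g /is_iso_epi gm] := isomorphic_sym AB.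
by rewrite (dim_hom_epi _ fm) (dim_hom_epi _ gm).
Qed.

Lemma dim_hom_sumr n (A : 'I_n -> C) S T : direct_sum A S ->
  \dim {:hom C T S} = (\sum_i \dim {:hom C T (A i)})%N.
Proof.
move=> [inj [proj [pi pi0 ip]]].
apply: (dim_direct_sum (f := fun i => comp (inj i)) (g := fun i => comp (proj
  i))).
- by move=> i a x y; exact: comp_linr.
- by move=> i a x y; exact: comp_linr.
- by move=> i w; rewrite comp_assoc pi comp_idl.
- by move=> i j w ij; rewrite comp_assoc pi0 // comp0l.
by move=> v; under eq_bigr do rewrite comp_assoc;
  rewrite -comp_suml ip comp_idl.
Qed.

Lemma dim_hom_suml n (A : 'I_n -> C) S T : direct_sum A S ->
  \dim {:hom C S T} = (\sum_i \dim {:hom C (A i) T})%N.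
Proof.
move=> [inj [proj [pi pi0 ip]]].
apply: (dim_direct_sum (f := fun i h => h \oc proj i) (g := fun i h => h \oc
  inj i)).
- by move=> i a x y; exact: comp_linl.
- by move=> i a x y; exact: comp_linl.
- by move=> i w; rewrite -comp_assoc pi comp_idr.
- by move=> i j w ij; rewrite -comp_assoc pi0 1?eq_sym // comp0r.
by move=> v; under eq_bigr do rewrite -comp_assoc;
  rewrite -comp_sumr ip comp_idr.
Qed.

Lemma direct_sum_iso n (A A' : 'I_n -> C) S :
  (forall i, isomorphic (A i) (A' i)) -> direct_sum A S -> direct_sum A' S.
Proof.
move=> iso [inj [proj [pi pi0 ip]]].
pose f i := projT1 (cid (iso i)); have f_iso i : is_iso (f i) := projT2 (cid
  (iso i)).
pose g i := projT1 (cid (f_iso i)).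
have fg i : g i \oc f i = idm (A i) /\ f i \oc g i = idm (A' i) := projT2 (cid
  (f_iso i)).
exists (fun i => inj i \oc g i), (fun i => f i \oc proj i); split=> [i|i j ij|].
- by rewrite -comp_assoc (comp_assoc (proj i)) pi comp_idl; case: (fg i).
- by rewrite -comp_assoc (comp_assoc (proj j)) pi0 // comp0l comp0r.
rewrite -ip; apply: eq_bigr => i _.
by rewrite -comp_assoc (comp_assoc (g i)); case: (fg i) => -> _;
  rewrite comp_idl.
Qed.

Lemma direct_sum1 (A : 'I_1 -> C) S : direct_sum A S -> isomorphic S (A ord0).
Proof.
move=> [inj [proj [pi _]]]; rewrite big_ord1 => ip.
by exists (proj ord0), (inj ord0).
Qed.

Section Simple.
Hypothesis C_abelian : abelian_category C.

(** The kernel of [f] is a subobject of a simple object: if it is zero, [f] is mono; if it is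
    everything, [f] is zero. *)
Lemma simple_mono X Y (f : hom C X Y) : simple X -> f <> 0 -> is_mono f.
Proof.
move=> [_ Xs] f0; have [_ /(_ X Y f)[N [k [fk kP]]] _ _ _] := C_abelian.
have km : is_mono k.
  move=> T x y kxy; have [|w [_ wP]] := kP T (k \oc x).
    by rewrite comp_assoc fk comp0l.
  by rewrite -(wP x) // -(wP y).
have [N0|[g [_ kg]]] := Xs N k km.
  move=> T x y fxy; apply/eqP; rewrite -subr_eq0.
  have [|w [<- _]] := kP T (x - y); first by rewrite compBr fxy subrr.
  by rewrite -(comp_idr k) N0 comp0r comp0l.
by case: f0; rewrite -(comp_idr f) -kg comp_assoc fk comp0l.
Qed.

Lemma simple_is_iso X Y (f : hom C X Y) :
  simple X -> simple Y -> f <> 0 -> is_iso f.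
Proof. by move=> Xs [_ Ys] /(simple_mono Xs) /Ys [] // X0; case: Xs. Qed.

End Simple.
End LinearCategory.

Section Schur.
Variables (K : numClosedFieldType) (C : linear_category K).
Hypothesis C_abelian : abelian_category C.

(** Schur's lemma. Composition with [f] has an eigenvector [g] in the endomorphism space; as a
    nonzero endomorphism of a simple object, [g] is invertible and cancels from [f g = a g]. *)
Lemma dim_simple_end (X : C) : simple X -> \dim {:hom C X X} = 1%N.
Proof.
move=> Xs; pose V := hom C X X; have id0 : idm X <> 0 by case: Xs.
suff VE : (<[idm X]>%VS == {:V}%VS).
  by rewrite -(eqP VE) dim_vline (introF eqP id0).
rewrite eqEsubv subvf; apply/subvP => f _; apply/vlineP.
pose fL := HB.pack_for {linear V -> V} (comp f)
  (GRing.isLinear.Build K V V *:%R (comp f) (fun a => comp_linr a f)).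
pose e := vbasis {:V}; have e_basis : basis_of {:V} e := vbasisP _.
have V_gt0 : (0 < \dim {:V})%N.
  by rewrite lt0n; apply/dim_neq0P; exists (idm X); apply/eqP.
have [a /eigenvalueP[w wM w0]] := eigenvalue_closed (passmx.mxof e e (linfun
  fL)) V_gt0.
pose g : V := passmx.vecof e w.
have fg : (- a *: idm X + f) \oc g = 0.
  rewrite comp_linl comp_idl -[f \oc g]/(fL g) -[fL g]lfunE /= /g.
  have v0 : passmx.vecof e 0 = 0 by apply/eqP;
    rewrite (passmx.vecof_eq0 e_basis).
  have vZ : passmx.vecof e (a *: w) = a *: passmx.vecof e w.
    by have := passmx.vecof_linear e a w 0; rewrite v0 !addr0.
  by rewrite (passmx.hom_vecof e e_basis) wM vZ scaleNr addNr.
exists a; apply/eqP; rewrite -subr_eq0 addrC -scaleNr; apply/eqP.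
apply: epi_eq0 fg; apply/is_iso_epi/simple_is_iso => //.
by apply/eqP; rewrite (passmx.vecof_eq0 e_basis).
Qed.
End Schur.

(** * Multiplicities of simple objects *)

Section Constituents.
Variables (R : realType) (C : fusion_category R).
Let C_abelian : abelian_category (fcat C) := @fusion_abelian R C.
Let C_semisimple (Y : C) : semisimple_object Y := fusion_semisimple Y.
Variables (m : nat) (X : 'I_m -> C).
Hypothesis X_simple : simple_representatives X.
Implicit Types (Y Z : C) (i j k : 'I_m).

Lemma simple_rep i : simple (X i). Proof. by case: X_simple. Qed.

Lemma dim_hom_simple_reps i k : \dim {:hom C (X i) (X k)} = (i == k).
Proof.
have [->|ik] := eqVneq i k; first exact/dim_simple_end/simple_rep.
apply/eqP/contraT => /dim_neq0P[f f0]; case: X_simple => _ /(_ i k) + _.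
move=> iso; rewrite iso ?eqxx // in ik.
by exists f; apply: (simple_is_iso C_abelian (simple_rep i) (simple_rep k));
  apply/eqP.
Qed.

Lemma mult_simple i k : mult X (X i) k = (k == i).
Proof. exact: dim_hom_simple_reps. Qed.

Lemma mult_iso Y Z k : isomorphic Y Z -> mult X Y k = mult X Z k.
Proof. exact: dim_hom_isor. Qed.

Lemma mult_sum n (A : 'I_n -> C) Y k : direct_sum A Y ->
  mult X Y k = (\sum_l mult X (A l) k)%N.
Proof. exact: dim_hom_sumr. Qed.

Lemma semisimple_reps Y :
  exists n (t : 'I_n -> 'I_m), direct_sum (fun l => X (t l)) Y.
Proof.
have [n [A [A_simple AY]]] := C_semisimple Y.
have /choice[t tP] l : exists i, isomorphic (A l) (X i).
  by case: X_simple => _ _; apply.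
by exists n, t; apply: direct_sum_iso AY.
Qed.

(** Both sides count the summands of [Y] isomorphic to [X k]. *)
Lemma dim_hom_to_rep Y k : \dim {:hom C Y (X k)} = mult X Y k.
Proof.
have [n [t tY]] := semisimple_reps Y.
rewrite (mult_sum k tY) (dim_hom_suml _ tY); apply: eq_bigr => l _.
by rewrite mult_simple dim_hom_simple_reps eq_sym.
Qed.

Lemma mult_neq0P Y k :
  reflect (exists f : hom C (X k) Y, f != 0) (mult X Y k != 0%N).
Proof. exact: dim_neq0P. Qed.

Lemma mult_mono Y Z (f : hom C Y Z) k : is_mono f -> (mult X Y k <= mult X Z
  k)%N.
Proof. exact: dim_hom_mono. Qed.

Lemma mult_epi Y Z (f : hom C Y Z) k : is_epi f -> (mult X Z k <= mult X Y k)%N.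
Proof. by rewrite -!dim_hom_to_rep; apply: dim_hom_epi. Qed.

Lemma mult1_iso Y k : (forall l, mult X Y l = (l == k)) -> isomorphic Y (X k).
Proof.
move=> Yk; have [n [t tY]] := semisimple_reps Y.
(* The sum of all multiplicities is the number of simple summands. *)
have n1 : n = 1%N.
  have <- : (\sum_l mult X Y l = 1)%N.
    by rewrite (bigD1 k) //= Yk eqxx big1 // => l /negPf lk; rewrite Yk lk.
  under eq_bigr do rewrite (mult_sum _ tY); rewrite exchange_big /=.
  rewrite -[LHS]card_ord -sum1_card; apply: eq_bigr => l _.
  rewrite (bigD1 (t l)) //= mult_simple eqxx big1 // => j jl.
  by rewrite mult_simple (negPf jl).
case: _ / (esym n1) t tY => t tY.
have tk : t ord0 = k.
  by have := mult_sum (t ord0) tY; rewrite Yk big_ord1 mult_simple eqxx;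
    case: eqP.
by rewrite -tk; apply: (direct_sum1 tY).
Qed.

End Constituents.

(** * The based ring of a fusion category *)

Section TensorCategory.
Variables (K : fieldType) (C : tensor_category K).
Implicit Types A B X Y Z : C.

Lemma tensm0l A A' B B' (g : hom C B B') : tensm (0 : hom C A A') g = 0.
Proof.
by have := tensm_linl (-1) (0 : hom C A A') 0 g;
  rewrite scaler0 addr0 scaleN1r addNr.
Qed.

Lemma tensm0r A A' B B' (f : hom C A A') : tensm f (0 : hom C B B') = 0.
Proof.
by have := tensm_linr (-1) f (0 : hom C B B') 0;
  rewrite scaler0 addr0 scaleN1r addNr.
Qed.

Lemma tensm_suml A A' B B' n (f : 'I_n -> hom C A A') (g : hom C B B') :
  tensm (\sum_i f i) g = \sum_i tensm (f i) g.
Proof.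
apply: (big_morph (fun f => tensm f g)) => [x y|]; last exact: tensm0l.
by have := tensm_linl 1 x y g; rewrite !scale1r.
Qed.

Lemma tensm_sumr A A' B B' n (f : hom C A A') (g : 'I_n -> hom C B B') :
  tensm f (\sum_i g i) = \sum_i tensm f (g i).
Proof.
apply: (big_morph (fun g => tensm f g)) => [x y|]; last exact: tensm0r.
by have := tensm_linr 1 f x y; rewrite !scale1r.
Qed.

Lemma tensm_compl A A' A'' Z (f' : hom C A' A'') (f : hom C A A') :
  tensm f' (idm Z) \oc tensm f (idm Z) = tensm (f' \oc f) (idm Z).
Proof. by rewrite -tensm_comp comp_idl. Qed.

Lemma tensm_compr A A' A'' Z (f' : hom C A' A'') (f : hom C A A') :
  tensm (idm Z) f' \oc tensm (idm Z) f = tensm (idm Z) (f' \oc f).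
Proof. by rewrite -tensm_comp comp_idl. Qed.

Lemma direct_sum_tensl n (A : 'I_n -> C) S Z :
  direct_sum A S -> direct_sum (fun i => tens (A i) Z) (tens S Z).
Proof.
move=> [inj [proj [pi pi0 ip]]].
exists (fun i => tensm (inj i) (idm Z)), (fun i => tensm (proj i) (idm Z)).
split=> [i|i j ij|]; first by rewrite tensm_compl pi tensm_id.
  by rewrite tensm_compl pi0 // tensm0l.
under eq_bigr do rewrite tensm_compl.
by rewrite -tensm_suml ip tensm_id.
Qed.

Lemma direct_sum_tensr n (A : 'I_n -> C) S Z :
  direct_sum A S -> direct_sum (fun i => tens Z (A i)) (tens Z S).
Proof.
move=> [inj [proj [pi pi0 ip]]].
exists (fun i => tensm (idm Z) (inj i)), (fun i => tensm (idm Z) (proj i)).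
split=> [i|i j ij|]; first by rewrite tensm_compr pi tensm_id.
  by rewrite tensm_compr pi0 // tensm0r.
under eq_bigr do rewrite tensm_compr.
by rewrite -tensm_sumr ip tensm_id.
Qed.

Lemma is_iso_tensm A A' B B' (f : hom C A A') (g : hom C B B') :
  is_iso f -> is_iso g -> is_iso (tensm f g).
Proof.
move=> [f' [f'f ff']] [g' [g'g gg']]; exists (tensm f' g').
by rewrite -!tensm_comp f'f g'g ff' gg' !tensm_id.
Qed.

Lemma isomorphic_tens A A' B B' :
  isomorphic A A' -> isomorphic B B' -> isomorphic (tens A B) (tens A' B').
Proof. by move=> [f fi] [g gi]; exists (tensm f g); apply: is_iso_tensm. Qed.

Lemma assoc_iso A B D : is_iso (assoc A B D).
Proof. by exists (associ A B D); rewrite assocK associK. Qed.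

Lemma associ_nat A A' B B' D D' (f : hom C A A') (g : hom C B B') (h : hom C D
  D') :
  associ A' B' D' \oc tensm f (tensm g h) = tensm (tensm f g) h \oc associ A B
    D.
Proof.
apply: (is_iso_mono (assoc_iso A' B' D')).
by rewrite !comp_assoc associK comp_idl assoc_nat -comp_assoc associK comp_idr.
Qed.

Lemma associ_pentagon A B D E :
  associ A B (tens D E) \oc tensm (idm A) (assoc B D E) =
  assoc (tens A B) D E \oc tensm (associ A B D) (idm E) \oc associ A (tens B D)
    E.
Proof.
apply: (is_iso_mono (assoc_iso A B (tens D E))).
rewrite !comp_assoc associK comp_idl -pentagon -!comp_assoc.
rewrite (comp_assoc (tensm (assoc A B D) _)) tensm_compl associK tensm_id
  comp_idl.
by rewrite associK comp_idr.
Qed.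

(* The usual inverse of [f |-> (id_X (x) f) o (coev (x) id_A)] sends the image
  of
   [f] to [f] up to associativity and unit isomorphisms. For injectivity it is
   enough that these are isomorphisms, so that no coherence for the unit is
   needed. *)
Lemma left_dual_adjunct_eq0 X Y (ev : hom C (tens Y X) (one C))
    (coev : hom C (one C) (tens X Y)) A B (f : hom C (tens Y A) B) :
  is_left_dual ev coev ->
  tensm (idm X) f \oc assoc X Y A \oc tensm coev (idm A) = 0 -> f = 0.
Proof.
move=> [_ zigzag] f0; pose h := tensm ev (idm Y) \oc associ Y X Y \oc tensm
  (idm Y) coev.
have h_iso : is_iso h.
  have [l [l_iso ll' _]] := is_iso_inv (lunit_iso Y).
  suff -> : h = l \oc runit Y by apply: is_iso_comp (runit_iso Y).
  by rewrite -zigzag -!comp_assoc (comp_assoc l) ll' comp_idl comp_assoc.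
pose b := assoc (one C) Y A \oc tensm h (idm A) \oc associ Y (one C) A.
have b_iso : is_iso b.
  apply: is_iso_comp; last by exists (assoc Y (one C) A);
    rewrite assocK associK.
  apply: is_iso_comp (assoc_iso _ _ _) _; exact: is_iso_tensm (is_iso_idm _).
suff fb : tensm (idm (one C)) f \oc b = 0.
  have f1 := epi_eq0 (is_iso_epi b_iso) fb.
  apply: (epi_eq0 (is_iso_epi (lunit_iso (tens Y A)))).
  by rewrite -lunit_nat f1 comp0r.
(* Tensor the hypothesis with [Y] and apply [ev]; naturality and the pentagon then bring [f] to the
   front and leave [b]. *)
have : tensm ev (idm B) \oc associ Y X B
    \oc tensm (idm Y) (tensm (idm X) f \oc assoc X Y A \oc tensm coev (idm A))
      = 0.
  by rewrite f0 tensm0r comp0r.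
rewrite -!tensm_compr !comp_assoc.
rewrite -(comp_assoc (tensm ev _) (associ _ _ _)) associ_nat comp_assoc.
rewrite tensm_id -tensm_comp comp_idl comp_idr => <-.
have -> : tensm ev f = tensm (idm (one C)) f \oc tensm ev (idm (tens Y A)).
  by rewrite -tensm_comp comp_idl comp_idr.
rewrite -!comp_assoc; congr (_ \oc _); rewrite (comp_assoc (associ _ _ _)
  (tensm _ _)).
rewrite associ_pentagon -!comp_assoc associ_nat -tensm_id.
rewrite [RHS]comp_assoc -assoc_nat -!comp_assoc; congr (_ \oc _).
by rewrite !comp_assoc !tensm_compl.
Qed.

End TensorCategory.

Section FusionRing.
Variables (R : realType) (C : fusion_category R) (m : nat) (X : 'I_m -> C).
Hypothesis X_simple : simple_representatives X.
Implicit Types (Y Z : C) (i j k l : 'I_m).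

Lemma mult_tensl Y Z k :
  mult X (tens Y Z) k = (\sum_i mult X Y i * mult X (tens (X i) Z) k)%N.
Proof.
have [n [t tY]] := semisimple_reps X_simple Y.
rewrite (mult_sum _ _ (direct_sum_tensl Z tY)).
under [RHS]eq_bigr do rewrite (mult_sum _ _ tY) big_distrl /=.
rewrite exchange_big; apply: eq_bigr => l _ /=.
rewrite (bigD1 (t l)) //= mult_simple // eqxx mul1n big1 ?addn0 // => i il.
by rewrite mult_simple // (negPf il).
Qed.

Lemma mult_tensr Y Z k :
  mult X (tens Z Y) k = (\sum_i mult X Y i * mult X (tens Z (X i)) k)%N.
Proof.
have [n [t tY]] := semisimple_reps X_simple Y.
rewrite (mult_sum _ _ (direct_sum_tensr Z tY)).
under [RHS]eq_bigr do rewrite (mult_sum _ _ tY) big_distrl /=.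
rewrite exchange_big; apply: eq_bigr => l _ /=.
rewrite (bigD1 (t l)) //= mult_simple // eqxx mul1n big1 ?addn0 // => i il.
by rewrite mult_simple // (negPf il).
Qed.

(** Half of the duality adjunction: maps from [Y^* X_k] to [X_j] embed into maps from [X_k] to
    [Y X_j]. *)
Lemma mult_dual_le Y j k :
  (mult X (tens (dual Y) (X k)) j <= mult X (tens Y (X j)) k)%N.
Proof.
have [ev [coev Yd]] := fusion_left_rigid Y.
rewrite -(dim_hom_to_rep X_simple) /mult.
have -> : \dim {:hom C (X k) (tens Y (X j))} =
          \dim {:hom C (tens (one C) (X k)) (tens Y (X j))}.
  by apply/esym/dim_hom_isol; exists (lunit (X k)); apply: lunit_iso.
apply: (dim_le_inj (f := fun f => tensm (idm Y) f \oc assoc Y (dual Y) (X k)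
                                   \oc tensm coev (idm (X k)))) => [a f g|f].
  by rewrite tensm_linr !comp_linl.
exact: left_dual_adjunct_eq0 Yd.
Qed.

Lemma gclass_rep (T : comNzRingType) i : gclass X T (X i) = delta_mx 0 i.
Proof. by apply/rowP => k; rewrite !mxE mult_simple // eqxx. Qed.

Lemma gmul_delta (T : comNzRingType) i j :
  gmul X (delta_mx 0 i) (delta_mx 0 j) = gclass X T (tens (X i) (X j)).
Proof.
rewrite /gmul (bigD1 i) //= [X in _ + X]big1 => [|k ki]; last first.
  by rewrite big1 // => l _; rewrite mxE (negPf ki) mul0r scale0r.
rewrite (bigD1 j) //= big1 => [|l lj]; last by rewrite !mxE (negPf lj) mulr0
  scale0r.
by rewrite !mxE !eqxx mulr1 scale1r !addr0.
Qed.

Hypothesis X_comm : grothendieck_commutative X.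
Local Notation N i j k := (mult X (tens (X i) (X j)) k).

Lemma mult_comm i j k : N i j k = N j i k.
Proof.
have /rowP/(_ k) := X_comm (delta_mx 0 i) (delta_mx 0 j).
by rewrite !gmul_delta !mxE => /eqP; rewrite eqr_nat => /eqP.
Qed.

(* Commutativity turns the one inequality of [mult_dual_le] into the fact that
   duals of simple objects are simple and duality is an involution on classes;
   applying the inequality twice then gives equality. *)
Lemma exists_fusion_ring : exists B : based_ring m,
  [/\ forall i j k, cf B i j k = N i j k,
      isomorphic (one C) (X (bunit B))
    & forall i, isomorphic (dual (X i)) (X (bstar B i))].
Proof.
have [u one_u] : exists u, isomorphic (one C) (X u).
  by case: X_simple => _ _; apply; exact: fusion_unit_simple.
have N1 Y k : mult X (tens (X u) Y) k = mult X Y k.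
  apply: mult_iso; apply: (isomorphic_trans (B := tens (one C) Y)).
    by apply: isomorphic_tens (isomorphic_sym one_u) _; exists (idm Y);
      apply: is_iso_idm.
  by exists (lunit Y); apply: lunit_iso.
have Nu i k : N i u k = (k == i) by rewrite mult_comm N1 mult_simple.
have le i j k : (\sum_l mult X (dual (X i)) l * N l k j <= N i j k)%N.
  by rewrite -mult_tensl mult_dual_le.
have le_u i j : (mult X (dual (X i)) j <= N i j u)%N.
  apply: leq_trans (le i j u); rewrite (bigD1 j) //= Nu eqxx muln1;
    exact: leq_addr.
have dual_neq0 i : exists l, mult X (dual (X i)) l != 0%N.
  have [[|n] [t tY]] := semisimple_reps X_simple (dual (X i)); last first.
    exists (t ord0); rewrite (mult_sum _ _ tY) (bigD1 ord0) //=.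
    by rewrite mult_simple // eqxx.
  (* A zero dual would have [ev = 0], and the zigzag identity would make [X i] zero. *)
  have [X0 _] := simple_rep X_simple i; case: X0; rewrite /is_zero.
  have [ev [coev [zigzag _]]] := fusion_left_rigid (X i).
  have Y0 : idm (dual (X i)) = 0 by case: tY => inj [proj [_ _ <-]];
    rewrite big_ord0.
  have ev0 : ev = 0 by rewrite -(comp_idr ev) -tensm_id Y0 tensm0l comp0r.
  have [l [_ <-]] := lunit_iso (X i).
  by rewrite -zigzag ev0 tensm0r comp0r !comp0l.
have /choice[s sP] i : exists j, forall l, mult X (dual (X i)) l = (l == j).
  have [j j0] := dual_neq0 i; exists j => l.
  (* By [le_u], each constituent [X p] of the dual has the unit in its product with [X i], and these
     occurrences number at most [N i u i = 1]. *)
  have le1 : (\sum_l mult X (dual (X i)) l <= 1)%N.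
    have := le i u i; rewrite Nu eqxx; apply: leq_trans; apply: leq_sum => p _.
    have [->|p0] := eqVneq (mult X (dual (X i)) p) 0%N; first by [].
    by rewrite leq_pmulr // mult_comm (leq_trans _ (le_u i p)) // lt0n.
  rewrite (bigD1 j) //= in le1; have j1 : (0 < mult X (dual (X i)) j)%N by
    rewrite lt0n.
  have [->|lj] := eqVneq l j.
    by apply/eqP; rewrite eqn_leq j1 (leq_trans (leq_addr _ _) le1).
  apply/eqP; rewrite -leqn0 -(leq_add2l 1) addn0; apply: leq_trans le1.
  by rewrite leq_add // (bigD1 l) //= leq_addr.
have {}le i j k : (N (s i) k j <= N i j k)%N.
  apply: leq_trans (le i j k); rewrite (bigD1 (s i)) //= sP eqxx mul1n;
    exact: leq_addr.
have Nsu i : N (s i) i u != 0%N.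
  rewrite mult_comm -lt0n; apply: leq_trans (le_u i (s i)); by rewrite sP eqxx.
(* The unit occurs in the product of [s i] and [s (s i)], so [le] makes [N i u (s (s i))]
   nonzero. *)
have sK : involutive s.
  move=> i; have := le i u (s (s i)); rewrite Nu mult_comm.
  by case: eqP => // _; rewrite leqn0 (negPf (Nsu (s i))).
have N_assoc i j l k : (\sum_p N i j p * N p l k = \sum_q N j l q * N i q k)%N.
  rewrite -mult_tensl -mult_tensr; apply: mult_iso.
  by exists (assoc (X i) (X j) (X l)); apply: assoc_iso.
have N_star i j k : N (s i) k j = N i j k.
  by apply/eqP; rewrite eqn_leq le -{1}(sK i) le.
have N_unit i k : N u i k = (i == k) by rewrite N1 mult_simple // eq_sym.
by exists (BasedRing mult_comm N_assoc N_unit N_star sK); split=> // i;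
  apply: mult1_iso => // l; rewrite sP.
Qed.

End FusionRing.

(** * Fusion subcategories and characters *)

Local Open Scope classical_set_scope.
Local Open Scope ring_scope.

Lemma adjoint_fusion_subcategory (R : realType) (C : fusion_category R) (D :
  set C) :
  fusion_subcategory (adjoint_subcategory D).
Proof.
split=> [E [[E1 _] //]|n A S DA AS E EP|A Y f|A Y DA DY E EP|A DA E EP].
- by have [[_ Esum _ _ _] _] := EP; apply: Esum AS => i; exact: DA.
- split=> [DY fm|DA fe] E EP; have [[_ _ /(_ A Y f)[Emono Eepi] _ _] _] := EP.
    by apply: Emono => //; exact: DY.
  by apply: Eepi => //; exact: DA.
- by have [[_ _ _ Etens _] _] := EP; apply: Etens; [exact: DA | exact: DY].
by have [[_ _ _ _ Edual] _] := EP; apply: Edual; exact: DA.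
Qed.

Lemma adjoint_subcategory_sub (R : realType) (C : fusion_category R) (D : set
  C) :
  fusion_subcategory D -> adjoint_subcategory D `<=` D.
Proof.
move=> D_sub; apply: smallest_sub => // _ [Y [DY _ ->]].
by have [_ _ _ Dtens Ddual] := D_sub; apply: Dtens => //; exact: Ddual.
Qed.

Lemma adjoint_subcategory_gen (R : realType) (C : fusion_category R) (D : set
  C) (Y : C) :
  D Y -> simple Y -> adjoint_subcategory D (tens Y (dual Y)).
Proof. by move=> DY Ys; apply: sub_gen_smallest; exists Y. Qed.

Lemma fusion_subcategoryT (R : realType) (C : fusion_category R) :
  fusion_subcategory [set: C].
Proof. by []. Qed.

Section FusionRingOf.
Variables (R : realType) (C : fusion_category R) (m : nat) (X : 'I_m -> C).
Hypothesis X_simple : simple_representatives X.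
Variable B : based_ring m.
Hypothesis cfE : forall i j k, cf B i j k = mult X (tens (X i) (X j)) k.
Hypothesis unitE : isomorphic (one C) (X (bunit B)).
Hypothesis starE : forall i, isomorphic (dual (X i)) (X (bstar B i)).
Local Notation u := (bunit B).
Local Notation s := (bstar B).
Implicit Types (Y Z : C) (i j k l : 'I_m) (D : set C).

Lemma mult_dual i k : mult X (dual (X i)) k = (k == s i).
Proof. by rewrite (mult_iso X k (starE i)) mult_simple. Qed.

Lemma mult_one k : mult X (one C) k = (k == u).
Proof. by rewrite (mult_iso X k unitE) mult_simple. Qed.

Lemma mult_tens Y Z k : (mult X (tens Y Z) k =
  \sum_i \sum_j mult X Y i * mult X Z j * cf B i j k)%N.
Proof.
rewrite mult_tensl //; apply: eq_bigr => i _; rewrite mult_tensr // big_distrr.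
by apply: eq_bigr => j _; rewrite /= cfE mulnA.
Qed.

Lemma mult_tens_supp Y Z k : mult X (tens Y Z) k != 0%N ->
  exists i j, [/\ mult X Y i != 0%N, mult X Z j != 0%N & cf B i j k != 0%N].
Proof.
rewrite mult_tens => /sum_nat_neq0[i /sum_nat_neq0[j]];
  rewrite !muln_eq0 !negb_or => /andP[/andP[]].
by exists i, j.
Qed.

(** By adjunction, [X k] in the dual of [Y] puts the unit in [Y X_k], hence in some [X_i X_k] with
    [X i] in [Y]; then [k = s i]. *)
Lemma mult_dual_supp Y k : mult X (dual Y) k != 0%N ->
  exists2 i, mult X Y i != 0%N & k = s i.
Proof.
rewrite -lt0n => k0; have := mult_dual_le X_simple Y k u.
have -> : mult X (tens (dual Y) (X u)) k = mult X (dual Y) k.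
  rewrite -(mult_iso X k (_ : isomorphic (tens (dual Y) (one C)) _)).
    by apply: mult_iso; exists (runit (dual Y)); apply: runit_iso.
  by apply: isomorphic_tens unitE; exists (idm (dual Y)); apply: is_iso_idm.
move=> /(leq_trans k0); rewrite lt0n => /mult_tens_supp[i [j [Yi]]].
rewrite mult_simple //; have [->|//] := eqVneq j k => _.
rewrite -{1}(bstarK B i) cf_star cf1r.
by have [<- _|//] := eqVneq (s i) k; exists i.
Qed.

Lemma subcategory_constituent D Y k : fusion_subcategory D -> D Y -> mult X Y k
  != 0%N -> D (X k).
Proof.
move=> D_sub DY /mult_neq0P[f f0]; have [_ _ /(_ _ _ f)[+ _] _ _] := D_sub;
  apply=> //.
apply: (simple_mono (@fusion_abelian R C)); first exact: simple_rep.
exact/eqP.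
Qed.

Lemma subcategory_subring D : fusion_subcategory D ->
  based_subring B [pred i | X i \in D].
Proof.
move=> D_sub; have [D1 _ _ Dtens Ddual] := D_sub.
split=> [|i j k|i]; rewrite !inE.
- by apply: (subcategory_constituent D_sub D1); rewrite mult_one eqxx.
- move=> Di Dj; rewrite cfE => Nk.
  exact: (subcategory_constituent D_sub (Dtens _ _ Di Dj) Nk).
move=> Di; apply: (subcategory_constituent D_sub (Ddual _ Di)).
by rewrite mult_dual eqxx.
Qed.

Lemma subring_adjoint D i k : i \in [pred i | X i \in D] -> cf B i (s i) k !=
  0%N ->
  k \in [pred k | X k \in adjoint_subcategory D].
Proof.
rewrite !inE => Di Nk; have ad_sub := @adjoint_fusion_subcategory R C D.
apply: (subcategory_constituent ad_sub).
  apply: adjoint_subcategory_gen Di _; exact: simple_rep.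
rewrite (mult_iso X k (_ : isomorphic _ (tens (X i) (X (s i))))) -?cfE //.
by apply: isomorphic_tens (starE i); exists (idm (X i)); apply: is_iso_idm.
Qed.

(** Bounds from above a subcategory defined as the smallest one, by controlling its simple objects
    only. *)
Lemma subring_subcategory (S : {pred 'I_m}) : based_subring B S ->
  fusion_subcategory [set Y : C | forall k, mult X Y k != 0%N -> k \in S].
Proof.
move=> [uS SM Sstar]; split=> /= [k|n A Y AS AY k|A Y f|A Y AS YS k|A AS k].
- by rewrite mult_one; have [->|] := eqVneq k u.
- rewrite (mult_sum _ _ AY) => /sum_nat_neq0[l]; exact: AS.
- split=> [YS fm|AS fe] k k0; [apply: YS|apply: AS]; rewrite -lt0n.
    by apply: leq_trans (mult_mono X k fm); rewrite lt0n.
  by apply: leq_trans (mult_epi X_simple k fe); rewrite lt0n.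
- move=> /mult_tens_supp[i [j [Ai Yj Nk]]]; exact: SM (AS i Ai) (YS j Yj) Nk.
by move=> /mult_dual_supp[i Ai ->]; exact: Sstar (AS i Ai).
Qed.

Lemma left_mult_mxE i : left_mult_mx X (X i) = Lmx B R i.
Proof. by apply/matrixP => j k; rewrite !mxE cfE. Qed.

(** The row of the [d k] shows that [d i] is an eigenvalue, and [dim_bound] shows that no
    nonnegative eigenvalue exceeds it. *)
Lemma FPdimE (d : 'I_m -> R) i : is_dim B d -> FPdim X (X i) = d i.
Proof.
move=> d_dim; have [d_gt0 _] := d_dim; rewrite /FPdim left_mult_mxE.
set A := [set a | _].
have Ad : A (d i).
  split; first exact: ltW; apply/eigenvalueP; exists (\row_k d k).
    exact: dim_row_eigen.
  by apply/eqP => /rowP/(_ i); apply/eqP; rewrite !mxE gt_eqF.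
have ubA : ubound A (d i).
  move=> a [a_ge0 /eigenvalueP[v va v0]]; rewrite -(ger0_norm a_ge0).
  apply: (dim_bound (v := v 0) d_dim) => [k|].
    by have /rowP/(_ k) := va; rewrite !mxE => <-; apply: eq_bigr => j _;
      rewrite mxE.
  by apply/existsP; apply: contraNT v0; rewrite negb_exists => /forallP v0;
    apply/eqP/rowP => k; rewrite mxE; have /negPn/eqP := v0 k.
apply/eqP; rewrite eq_le ge_sup ?ub_le_sup //; last by exists (d i).
by exists (d i).
Qed.

(** * Characters as functionals on the complexified Grothendieck ring *)

Section Characters.
Local Open Scope complex_scope.

Lemma functionalE (c : 'I_m -> R[i]) (h : 'rV[R[i]]_m) :
  functional c h = \sum_k h 0 k * c k.
Proof.
pose f (h : 'rV[R[i]]_m) : R[i]^o := \sum_(k < m) h 0 k * c k.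
have f_lin : linear f.
  move=> a x y; rewrite scaler_sumr -big_split; apply: eq_bigr => k _ /=.
  by rewrite !mxE mulrDl -mulrA.
pose fL := HB.pack_for {linear 'rV[R[i]]_m -> R[i]^o} f
  (GRing.isLinear.Build R[i] 'rV[R[i]]_m R[i]^o *:%R f f_lin).
by rewrite /functional -[linfun _]/(linfun fL) lfunE.
Qed.

Lemma functional_basis (c : 'I_m -> R[i]) k : functional c (basis_elt X k) = c
  k.
Proof.
rewrite functionalE /basis_elt gclass_rep // (bigD1 k) //= big1 => [|j jk].
  by rewrite mxE !eqxx mul1r addr0.
by rewrite mxE (negPf jk) mul0r.
Qed.

Lemma functional_Bhat (mu : 'I_m -> R[i]) : is_char B mu -> Bhat X (functional
  mu).
Proof.
move=> [mu1 muM]; split=> [|v w].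
  rewrite functionalE (bigD1 u) //= big1 => [|k ku].
    by rewrite mxE mult_one eqxx mul1r mu1 addr0.
  by rewrite mxE mult_one (negPf ku) mul0r.
rewrite !functionalE mulr_suml.
under eq_bigr do rewrite /gmul summxE mulr_suml.
rewrite exchange_big; apply: eq_bigr => i _ /=.
rewrite mulr_sumr; under eq_bigr do rewrite summxE mulr_suml.
rewrite exchange_big; apply: eq_bigr => j _ /=.
rewrite mulrACA muM mulr_sumr; apply: eq_bigr => k _.
by rewrite !mxE -cfE mulrA.
Qed.

(* Evaluating the grouplike equation at the unit object shows that its scalar is
   [1], whichever value [dual_coef] takes. *)
Lemma grouplike_star (d : 'I_m -> R) (mu : 'I_m -> R[i]) i : is_dim B d ->
  is_char B mu -> dual_grouplike X (functional mu) ->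
  mu i * mu (s i) = (d i)%:C ^+ 2.
Proof.
move=> d_dim [mu1 muM]; rewrite /dual_grouplike;
  set c := dual_coef _ _ _ _ => E.
have [dC_gt0 [dC1 _]] := dim_complex d_dim.
have star_basis k : star X (functional mu) (sharp X (functional mu)) (basis_elt
  X k)
    = mu k * mu (s k) / (d k)%:C.
  rewrite /star functional_basis (FPdimE k d_dim) !linearZ /= /sharp
    !functional_basis.
  have -> : gclass X _ (dual (X k)) = basis_elt X (s k).
    by apply/rowP => l; rewrite !mxE mult_dual mult_simple.
  rewrite functional_basis; have /gt_eqF/negbT d0 := dC_gt0 k.
  by rewrite -![_ *: _]/(_ * _) mulrA mulVKf // mulrCA mulrC.
have Ek k : mu k * mu (s k) / (d k)%:C = c * (d k)%:C.
  by rewrite -star_basis E scale_lfunE /FPdim_functional functional_basis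
    (FPdimE k d_dim).
have su : s u = u.
  by have := cf_starl B u; rewrite cf1r; case: eqP.
have c1 : c = 1 by have := Ek u; rewrite su mu1 dC1 invr1 !mulr1.
have /gt_eqF/negbT d0 := dC_gt0 i; have := Ek i;
  rewrite c1 mul1r => /(canRL (divfK d0)) ->.
by rewrite expr2.
Qed.

(** The objects whose simple constituents lie in the kernel of [mu] form a fusion subcategory. It
    contains every generator of the adjoint subcategory, by the equality case of the triangle
    inequality. *)
Lemma adjoint_char_eq_dim (d : 'I_m -> R) (mu : 'I_m -> R[i]) : is_dim B d ->
  is_char B mu -> (forall i, mu i * mu (s i) = (d i)%:C ^+ 2) ->
  forall k, X k \in adjoint_subcategory [set: C] -> mu k = (d k)%:C.
Proof.
move=> d_dim muC mu_star k; rewrite inE => Xk.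
have sub := subring_subcategory (char_eq_dim_subring d_dim muC mu_star).
have gen : [set Y | exists Z : C, [/\ [set: C] Z, simple Z & Y = tens Z (dual
  Z)]] `<=`
    [set Y : C | forall l, mult X Y l != 0%N -> l \in [pred j | mu j == (d
      j)%:C]].
  move=> _ [Z [_ Zs ->]] l /=; have [_ _ /(_ Z Zs)[x Zx]] := X_simple.
  move=> /mult_tens_supp[i [j [Zi]]].
  have ZE y : mult X Z y != 0%N -> y = x.
    by rewrite (mult_iso X y Zx) mult_simple //; have [->|] := eqVneq y x.
  rewrite (ZE i Zi) => /mult_dual_supp[y /ZE -> ->] xl.
  rewrite inE; apply/eqP; apply: (char_eq_dim_supp d_dim muC _ xl).
  by rewrite mu_star (dim_star d_dim) expr2.
have /(_ k) := smallest_sub sub gen Xk.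
by rewrite mult_simple // eqxx => /(_ isT) /eqP.
Qed.

End Characters.

(** * Nilpotent fusion categories *)

Section Nilpotent.
Variable d : 'I_m -> R.
Hypothesis d_dim : is_dim B d.

(** Induction along the adjoint chain: over Vec the orbit is [x_i] alone, and each step up
    multiplies its dimension by the number of smaller orbits in it. *)
Lemma nilpotent_orbit n D : fusion_subcategory D ->
  iter n adjoint_subcategory D `<=` Vec ->
  forall i, exists q : nat, dim_of d (orbit_of B [pred j | X j \in D] i) = q%:R
    * d i ^+ 2.
Proof.
elim: n D => [|n IHn] D D_sub.
  move=> /= DV i; exists 1%N; rewrite mul1r /dim_of (bigD1 i) /=; last first.
    by apply: orbit_of_refl; apply: subcategory_subring.
  rewrite big1 ?addr0 // => k /andP[/orbit_ofP[a]]; rewrite inE => Da.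
  have [n aV] : Vec (X a) by apply: DV.
  have -> : a = u.
    have := mult_sum X a aV; rewrite mult_simple // eqxx.
    by under eq_bigr do rewrite mult_one; have [->//|_] := eqVneq a u;
      rewrite big1.
  by rewrite cf1; have [|] := eqVneq i k.
rewrite iterSr => adV i; have ad_sub := @adjoint_fusion_subcategory R C D.
have [q Eq] := IHn _ ad_sub adV i.
have [|n' ->] := dim_of_orbit_mul d_dim (subcategory_subring D_sub)
  (subcategory_subring ad_sub) (@subring_adjoint D) i.
  by move=> k; rewrite !inE; apply: adjoint_subcategory_sub.
by exists (n' * q)%N; rewrite Eq natrM mulrA.
Qed.

Lemma nilpotent_dim : nilpotent C -> exists2 Q : nat,
  dim_of d [pred j | X j \in adjoint_subcategory [set: C]] = Q%:R &
  forall i, exists q : nat, Q%:R = q%:R * d i ^+ 2.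
Proof.
set T := [pred j | _] => -[n nV].
have ad_sub := @adjoint_fusion_subcategory R C [set: C].
(* The chain now starts at the adjoint subcategory, one step later; for length zero the whole
   category is already Vec. *)
have [n' adV] : exists n', iter n' adjoint_subcategory (adjoint_subcategory
  [set: C])
    `<=` @Vec R C.
  case: n nV => [|n] nV; last by exists n; rewrite -iterSr nV.
  by exists 0%N; rewrite /= -nV.
have T_sub : based_subring B T := subcategory_subring ad_sub.
(* All simple objects form one orbit under the whole category, so every orbit of [T] has the
   dimension of the orbit of the unit, which is [T]. *)
have orb i : dim_of d (orbit_of B T i) = dim_of d T.
  rewrite -(dim_of_eq d (orbit_of_unit B T)).
  have all_sub := subcategory_subring (@fusion_subcategoryT R C).
  apply: (dim_of_orbit_eq d_dim all_sub T_sub (@subring_adjoint _)).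
  apply/orbit_ofP; exists i; first by rewrite !inE.
  by rewrite cf1r eqxx.
have q_ex i := nilpotent_orbit ad_sub adV i.
have [Q QE] := q_ex u; rewrite orb (dim_unit d_dim) expr1n mulr1 in QE.
by exists Q => // i; have [q] := q_ex i; rewrite orb QE; exists q.
Qed.

End Nilpotent.

End FusionRingOf.

Theorem theorem1p18 (R : realType) (C : fusion_category R)
    (m : nat) (X : 'I_m -> C) :
  simple_representatives X ->
  grothendieck_commutative X ->
  dual_burnside X ->
  let C_ad := adjoint_subcategory [set: C] in
  (\prod_(i < m) FPdim X (X i)) ^+ 2 / FPdim_subcategory X C_ad
    \is a Num.int
  /\
  (nilpotent C ->
   prime_divisors (FPdim_subcategory X C_ad) =
   \bigcup_(i in [set: 'I_m]) prime_divisors (FPdim X (X i) ^+ 2)).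
Proof.
move=> X_simple X_comm X_burnside C_ad.
have [B [cfE unitE starE]] := exists_fusion_ring X_simple X_comm.
have [d d_dim] := exists_dim R B; have [d_gt0 _] := d_dim.
pose S := [pred i | X i \in C_ad].
have S_sub : based_subring B S.
  exact: subcategory_subring (@adjoint_fusion_subcategory R C setT).
have dimS : FPdim_subcategory X C_ad = dim_of d S.
  by apply: eq_bigr => i _; rewrite (FPdimE cfE i d_dim).
have -> : \prod_(i < m) FPdim X (X i) = \prod_i d i.
  by apply: eq_bigr => i _; rewrite (FPdimE cfE i d_dim).
have S_gt0 : 0 < dim_of d S by apply: (dim_of_gt0 d_dim); case: S_sub.
have [n nE] : exists n : nat, (\prod_i d i) ^+ 2 = n%:R * dim_of d S.
  apply: (dim_prod_sqr d_dim S_sub) => [i k|mu muC].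
    by apply: (subring_adjoint X_simple cfE starE); rewrite !inE.
  have [_ burnside] := X_burnside _ (functional_Bhat X_simple cfE unitE muC).
  (* A character that is not grouplike vanishes somewhere, which is the first case of the
     dichotomy. *)
  have [glike|/burnside[i mui0]] := EM (dual_grouplike X (functional mu));
    last first.
    by left; exists i; rewrite -(functional_basis X_simple mu).
  have mu_star i := grouplike_star X_simple cfE starE i d_dim muC glike.
  right; split=> // k kS.
  apply: (adjoint_char_eq_dim X_simple cfE unitE d_dim muC mu_star).
  exact: kS.
rewrite dimS; split; first by rewrite nE mulfK ?gt_eqF // natr_int.
move=> C_nil; have [Q QE qE] := nilpotent_dim X_simple cfE unitE starE d_dim
  C_nil.
rewrite [dim_of d S]QE in nE S_gt0 *; rewrite ltr0n in S_gt0.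
have q_gt0 i q : Q%:R = q%:R * d i ^+ 2 -> (0 < q)%N.
  by move=> E; rewrite lt0n; apply: contraTneq S_gt0 => q0;
    move: E; rewrite q0 mul0r => /eqP; rewrite pnatr_eq0 => /eqP ->.
(* [d i ^+ 2] is the rational number [Q / q], so integrality applies. *)
have /choice[e eE] i : exists e : nat, d i ^+ 2 = e%:R.
  by have [q E] := qE i; apply: (sqr_dim_nat d_dim (q_gt0 i q E) E).
have e_dvd i : (e i %| Q)%N.
  have [q] := qE i; rewrite eE -natrM => /eqP; rewrite eqr_nat => /eqP ->.
  exact: dvdn_mull.
have prodE : (\prod_i e i = n * Q)%N.
  apply/eqP; rewrite -(eqr_nat R) natrM -nE natr_prod -prodrXl.
  by apply/eqP/eq_bigr => i _.
have nat_eq (x : R) a b : x = a%:R -> x = b%:R -> a = b.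
  by move=> -> /eqP; rewrite eqr_nat => /eqP.
apply/seteqP; split=> p /=.
  (* A prime divisor of [Q] divides [n * Q], the product of the [e i], hence one of the factors. *)
  move=> [p_prime [a aQ pa]].
  have pQ : (p %| Q)%N by rewrite (nat_eq _ _ _ erefl aQ).
  have : (p %| \prod_i e i)%N by rewrite prodE dvdn_mull.
  rewrite Euclid_dvd_prod // big_has => /hasP[i _ pei].
  exists i => //; split=> //; exists (e i) => //.
  by rewrite (FPdimE cfE i d_dim).
move=> [i _ [p_prime [a]]]; rewrite (FPdimE cfE i d_dim) => aE pa.
split=> //; exists Q => //; apply: dvdn_trans (e_dvd i).
by rewrite (nat_eq _ _ _ (eE i) aE).
Qed.
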